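(* Let $\Gamma$ be a finite simplicial graph and let $A(\Gamma)$ be the associated right-angled Artin group. Then $$\operatorname{asdim}A(\Gamma)=\operatorname{Sim}(\Gamma).$$
   Context: For a metric space $X$, $\operatorname{asdim}X\le n$ means: for every $R>0$ there is a covering $\mathcal U$ of $X$ by sets of uniformly bounded diameter such that every $R$-ball in $X$ intersects at most $n+1$ elements of $\mathcal U$; $\operatorname{asdim}X$ is the least such $n$ ($\infty$ if there is none). A finitely generated group is viewed as a metric space with the word metric of a finite generating set. The right-angled Artin group of $\Gamma$ is $A(\Gamma)=\langle s_u,\ u\in V(\Gamma)\mid s_us_vs_u^{-1}s_v^{-1},\ [u,v]\in E(\Gamma)\rangle$. $\operatorname{Sim}(\Gamma)=\max\{n\mid \Gamma \text{ contains the 1-skeleton of the standard }(n-1)\text{-simplex }\Delta^{n-1}\}$, i.e. the maximal number of vertices of a complete subgraph of $\Gamma$. *)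

(* Defs.v *)
From HB Require Import structures.
From mathcomp Require Import all_boot all_order all_algebra finmap.
From mathcomp Require Import generic_quotient.
From mathcomp Require Import all_classical all_reals all_analysis.

Set Implicit Arguments.
Unset Strict Implicit.
Unset Printing Implicit Defensive.

Import Order.TTheory GRing.Theory Num.Theory.

Local Open Scope classical_set_scope.
Local Open Scope quotient_scope.
Local Open Scope card_scope.
Local Open Scope ring_scope.

Section AsymptoticDimension.
Variables (R : realType) (X : metricType R).

Definition uniformly_bounded (U : set (set X)) : Prop :=
  exists D : R, forall A, U A -> forall x y, A x -> A y -> mdist x y <= D.

Definition asdim_le (n : nat) : Prop :=
  forall r : R, 0 < r ->
    exists U : set (set X),
      [/\ \bigcup_(A in U) A = setT,
          uniformly_bounded U &
          forall x : X, [set A | U A /\ A `&` ball x r !=set0] #<= `I_n.+1].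

(* The infimum is over a set of naturals: it is the least element when the set
   is nonempty and +oo otherwise. *)
Definition asdim : \bar R := ereal_inf [set n%:R%:E | n in asdim_le].

End AsymptoticDimension.

Section WordMetric.
Local Open Scope group_scope.
Variable G : groupType.

Definition is_word (S : {fset G}) (w : seq G) : bool :=
  all (fun x => (x \in S) || (x^-1 \in S)) w.

Definition generating (S : {fset G}) : Prop :=
  forall g : G, exists2 w : seq G, is_word S w & \prod_(x <- w) x = g.

Variables (S : {fset G}) (hS : generating S).

Definition has_word_of_size (g : G) (n : nat) : Prop :=
  exists w : seq G, [/\ is_word S w, \prod_(x <- w) x = g & size w = n].

Lemma word_norm_subproof (g : G) : exists n, `[< has_word_of_size g n >].
Proof. by have [w Sw wg] := hS g; exists (size w); apply/asboolP; exists w. Qed.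

Definition word_norm (g : G) : nat := ex_minn (word_norm_subproof g).

Definition word_dist (g h : G) : nat := word_norm (g^-1 * h).

Lemma word_normP g : has_word_of_size g (word_norm g).
Proof. by rewrite /word_norm; case: ex_minnP => n /asboolP. Qed.

Lemma word_norm_le g n : has_word_of_size g n -> (word_norm g <= n)%N.
Proof. by rewrite /word_norm; case: ex_minnP => m _ h /asboolP/h. Qed.

Lemma word_norm_eq0 g : word_norm g = 0%N -> g = 1.
Proof.
move=> g0; have [w [_ wg]] := word_normP g.
by rewrite g0 => /size0nil w0; rewrite -wg w0 big_nil.
Qed.

Lemma word_norm1 : word_norm 1 = 0%N.
Proof.
by apply/eqP; rewrite -leqn0; apply: word_norm_le; exists [::]; rewrite big_nil.
Qed.

Lemma word_normM g h : (word_norm (g * h) <= word_norm g + word_norm h)%N.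
Proof.
have [u [Su <- <-]] := word_normP g; have [v [Sv <- <-]] := word_normP h.
apply: word_norm_le; exists (u ++ v).
by rewrite /is_word all_cat big_cat size_cat; split=> //; apply/andP.
Qed.

Lemma word_normV_le g : (word_norm g^-1 <= word_norm g)%N.
Proof.
have [w [Sw <- <-]] := word_normP g; apply: word_norm_le.
exists (rev [seq x^-1 | x <- w]); split; last by rewrite size_rev size_map.
  rewrite /is_word all_rev all_map; apply: sub_all Sw => x /=.
  by rewrite invgK orbC.
elim: w {Sw} => [|x w IH]; first by rewrite !big_nil invg1.
by rewrite /= rev_cons -cats1 big_cat /= IH big_seq1 big_cons invgM.
Qed.

Lemma word_normV g : word_norm g^-1 = word_norm g.
Proof.
by apply/eqP; rewrite eqn_leq word_normV_le -{1}[g]invgK word_normV_le.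
Qed.

End WordMetric.

(* G with the word metric of S; a separate type because the metric depends on
   the generating set. *)
Definition word_space (R : realType) (G : groupType) (S : {fset G})
  (hS : generating S) : Type := G.

Section WordSpace.
Variables (R : realType) (G : groupType) (S : {fset G}) (hS : generating S).
Local Notation W := (word_space R hS).

HB.instance Definition _ := Choice.copy W G.

Let d (g h : W) : R := (word_dist hS g h)%:R.

Let dxx g : d g g = 0.
Proof. by rewrite /d /word_dist mulVg word_norm1. Qed.

Let d_eq0 g h : d g h = 0 -> g = h.
Proof.
move=> /eqP; rewrite /d pnatr_eq0 => /eqP /word_norm_eq0 gh.
by rewrite -[RHS](mulVKg (g : G)) gh mulg1.
Qed.

Let d_sym g h : d g h = d h g.
Proof. by rewrite /d /word_dist -word_normV invgM invgK. Qed.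

Let d_triangle h g k : d g k <= d g h + d h k.
Proof.
rewrite /d /word_dist -natrD ler_nat.
have -> : ((g : G)^-1 * k = ((g : G)^-1 * h) * ((h : G)^-1 * k))%g.
  by rewrite mulgA -(mulgA _ (h : G)) mulgV mulg1.
exact: word_normM.
Qed.

HB.instance Definition _ := isMetric.Build R W dxx d_eq0 d_sym d_triangle.

End WordSpace.

Section PresentedGroup.
Variable T : choiceType.

(* (s, false) stands for the letter s and (s, true) for its inverse. *)
Definition fword : Type := seq (T * bool).
HB.instance Definition _ := Choice.on fword.

Variable rels : set fword.

Inductive pres_eqv : fword -> fword -> Prop :=
| pres_refl u : pres_eqv u u
| pres_sym u v : pres_eqv u v -> pres_eqv v u
| pres_trans u v w : pres_eqv u v -> pres_eqv v w -> pres_eqv u w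
| pres_cancel u v s b : pres_eqv (u ++ (s, b) :: (s, ~~ b) :: v) (u ++ v)
| pres_relator u r v : rels r -> pres_eqv (u ++ r ++ v) (u ++ v).

Definition pres_rel : rel fword := fun u v => `[< pres_eqv u v >].

Lemma pres_rel_equiv : equiv_class_of pres_rel.
Proof.
split=> [u|u v|v u w]; first by apply/asboolP; exact: pres_refl.
- by apply/asboolP/asboolP; exact: pres_sym.
- by move=> /asboolP uv /asboolP vw; apply/asboolP; exact: pres_trans uv vw.
Qed.

Canonical pres_equiv_rel := EquivRelPack pres_rel_equiv.

(* The group < T | rels > *)
Definition presented : Type := {eq_quot pres_equiv_rel}.
HB.instance Definition _ := Choice.on presented.
HB.instance Definition _ := EqQuotient.on presented.

Definition fword_inv (u : fword) : fword := rev [seq (l.1, ~~ l.2) | l <- u].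

Definition pres_pi (u : fword) : presented := \pi u.

Lemma pres_piP u v : pres_pi u = pres_pi v <-> pres_eqv u v.
Proof.
split=> [/eqmodP/asboolP//|uv]; exact/eqmodP/asboolP.
Qed.

Lemma pres_repr (u : fword) : pres_eqv (repr (pres_pi u)) u.
Proof. by apply/pres_piP; rewrite /pres_pi reprK. Qed.

Lemma pres_eqv_cat u u' v v' :
  pres_eqv u u' -> pres_eqv v v' -> pres_eqv (u ++ v) (u' ++ v').
Proof.
move=> uu' vv'; apply: (@pres_trans _ (u' ++ v)).
- elim: uu' v {vv'} => {u u'} [u|u u' _ IH|u v w _ IH1 _ IH2|u v s b|u r v rr] x.
  + exact: pres_refl.
  + exact: pres_sym.
  + exact: pres_trans (IH1 x) (IH2 x).
  + by rewrite -!catA /=; exact: pres_cancel.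
  + by rewrite -!catA; exact: pres_relator.
- elim: vv' => {u uu' v v'} [u|u v _ IH|u v w _ IH1 _ IH2|u v s b|u r v rr].
  + exact: pres_refl.
  + exact: pres_sym.
  + exact: pres_trans IH1 IH2.
  + by rewrite !catA; exact: pres_cancel.
  + by rewrite (catA u' u (r ++ v)) (catA u' u v); exact: pres_relator.
Qed.

Lemma fword_invK : involutive fword_inv.
Proof.
move=> u; rewrite /fword_inv map_rev revK -map_comp map_id_in // => -[s b] _ /=.
by rewrite negbK.
Qed.

Lemma pres_mulV u : pres_eqv (u ++ fword_inv u) [::].
Proof.
elim: u => [|[s b] u IH]; first exact: pres_refl.
rewrite /fword_inv /= rev_cons -cats1 catA -cat_cons -[_ :: _]/([:: (s, b)] ++ _).
apply: pres_trans (pres_cancel [::] [::] s b).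
rewrite -[_ :: _ :: _]/([:: (s, b)] ++ [::] ++ [:: (s, ~~ b)]).
rewrite -catA; apply: pres_eqv_cat (pres_refl _) _.
exact: pres_eqv_cat IH (pres_refl _).
Qed.

Lemma pres_mulVl u : pres_eqv (fword_inv u ++ u) [::].
Proof. by rewrite -{2}[u]fword_invK; exact: pres_mulV. Qed.

Lemma pres_eqv_inv u v : pres_eqv u v -> pres_eqv (fword_inv u) (fword_inv v).
Proof.
move=> uv; apply: (@pres_trans _ (fword_inv u ++ (v ++ fword_inv v))).
  rewrite -{1}[fword_inv u]cats0; apply: pres_eqv_cat (pres_refl _) _.
  exact/pres_sym/pres_mulV.
rewrite catA -{2}[fword_inv v]cat0s; apply: pres_eqv_cat (pres_refl _).
apply: pres_trans (pres_mulVl u); apply: pres_eqv_cat (pres_refl _) _.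
exact: pres_sym.
Qed.

Definition pres_one : presented := pres_pi [::].
Definition pres_mul (x y : presented) : presented := pres_pi (repr x ++ repr y).
Definition pres_inv (x : presented) : presented := pres_pi (fword_inv (repr x)).

Lemma pres_piM u v : pres_mul (pres_pi u) (pres_pi v) = pres_pi (u ++ v).
Proof. by apply/pres_piP; apply: pres_eqv_cat; exact: pres_repr. Qed.

Lemma pres_piV u : pres_inv (pres_pi u) = pres_pi (fword_inv u).
Proof. by apply/pres_piP; apply: pres_eqv_inv; exact: pres_repr. Qed.

Lemma pres_ind (P : presented -> Prop) :
  (forall u, P (pres_pi u)) -> forall x, P x.
Proof. by move=> Pu x; rewrite -[x]reprK; exact: Pu. Qed.

Lemma pres_mulA : associative pres_mul.
Proof.
elim/pres_ind=> u; elim/pres_ind=> v; elim/pres_ind=> w.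
by rewrite !pres_piM catA.
Qed.

Lemma pres_mul1g : left_id pres_one pres_mul.
Proof. by elim/pres_ind=> u; rewrite pres_piM. Qed.

Lemma pres_mulg1 : right_id pres_one pres_mul.
Proof. by elim/pres_ind=> u; rewrite pres_piM cats0. Qed.

Lemma pres_mulVg : left_inverse pres_one pres_inv pres_mul.
Proof.
by elim/pres_ind=> u; rewrite pres_piV pres_piM; apply/pres_piP/pres_mulVl.
Qed.

Lemma pres_mulgV : right_inverse pres_one pres_inv pres_mul.
Proof.
by elim/pres_ind=> u; rewrite pres_piV pres_piM; apply/pres_piP/pres_mulV.
Qed.

HB.instance Definition _ := isGroup.Build presented
  pres_mulA pres_mul1g pres_mulg1 pres_mulVg pres_mulgV.

Definition pres_gen (s : T) : presented := pres_pi [:: (s, false)].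

End PresentedGroup.

Record sgraph := SGraph {
  vertex :> finType;
  adj : rel vertex;
  adj_sym : symmetric adj;
  adj_irrefl : irreflexive adj
}.

Section RightAngledArtin.
Variable Gamma : sgraph.

Definition is_clique (K : {set Gamma}) : bool :=
  [forall x in K, forall y in K, (x != y) ==> adj x y].

Definition Sim : nat := \max_(K : {set Gamma} | is_clique K) #|K|.

Definition raag_relators : set (fword Gamma) :=
  [set r | exists u v : Gamma, adj u v /\
     r = [:: (u, false); (v, false); (u, true); (v, true)]].

Definition raag : groupType := presented raag_relators.

Definition raag_gen (u : Gamma) : raag := pres_gen raag_relators u.

Lemma raag_gen_generating : generating [fset raag_gen u | u : Gamma]%fset.
Proof.
elim/pres_ind=> u; elim: u => [|[s b] u [w Sw wu]].
  by exists [::] => //; rewrite big_nil.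
exists ((if b then (raag_gen s)^-1 else raag_gen s)%g :: w).
  rewrite /is_word /= -/(is_word _ _) Sw andbT.
  have Ss : raag_gen s \in [fset raag_gen u | u : Gamma]%fset.
    by apply/imfsetP; exists s.
  by case: b; rewrite ?invgK Ss ?orbT.
rewrite big_cons wu -[RHS](pres_piM _ [:: (s, b)] u); congr pres_mul.
by case: b => //; rewrite [LHS]pres_piV.
Qed.

End RightAngledArtin.

Arguments raag_relators : clear implicits.

(* Main.v *)
Require Import Defs.
From mathcomp Require Import all_boot all_order all_algebra finmap.
From mathcomp Require Import perm.
From mathcomp Require Import all_classical all_reals all_analysis.

(** Let n be the size of a largest clique.

    Words. A word is described by its restrictions to the pairs of vertices
    that are not adjacent (the pairs [u = u] included); two words with the same
    restrictions differ by swaps of neighbouring commuting letters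
    ([same_trace_invariant]). Appending a letter, or deleting its inverse when
    that can be carried to the end, is an action on reduced words up to this
    equivalence which satisfies the relations of the group. So each element [x]
    has a word [word_of x], well defined up to commutation, and neighbours in
    the Cayley graph have words that differ by one final letter
    ([word_of_step]).

    Upper bound. It is enough to construct, for each L, maps T_1, ..., T_L of
    the group into itself that move points by a bounded amount, such that for
    each x the elements T_i x take at most n + 1 values, and such that for
    neighbours x, y the elements T_i x and T_i y differ for one i at most. For
    if k bounds the number of indices at which points of an r-ball can differ
    from its centre and L > k (n + 1), the sets of those x for which T_i x = z
    for more than k indices i form the cover wanted ([asdim_le_Sim]). In the
    group of integer vectors, T_i rounds each coordinate of x up or down to a
    multiple of L according to whether its remainder is at least i, and each
    coordinate jumps once as i varies. In general the occurrences of a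
    vertex v in the word of x serve as coordinate v, cut into blocks of
    length L; but there are too many coordinates. To repair this, put one chip
    on each letter, and let the chips of v fill the blocks of v from the
    beginning of the word. While a chip of v lies in a block whose start comes
    after the start of a block of some u that does not commute with v and is
    not full, move a chip from v to u. Chips only move towards the beginning,
    so this comes to rest, and then the vertices with a partially filled block
    form a clique ([fractional_adj]): only n coordinates can jump
    ([truncation_values]). A move preserves the relation of differing by one
    chip ([pour_add_chip]), so the configurations at rest of neighbours differ
    by one chip ([settle_rcons]). Finally T_i x is the smallest prefix of x
    that contains the blocks holding at least i chips, up to one block for each
    vertex.

    Lower bound. A clique of size n spans a lattice of rank n, whose
    coordinates extend to the group as exponent sums. A cover of the group by
    uniformly bounded sets induces a labelling of a large lattice cube, to
    which Sperner's lemma applies ([cubical_sperner]): some unit cube meets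
    n + 1 members of the cover ([asdim_ge_clique]). Sperner's lemma is proved
    by counting, modulo 2, the fully labelled simplices of the Freudenthal
    triangulation. *)

Set Implicit Arguments.
Unset Strict Implicit.
Unset Printing Implicit Defensive.

Import Order.TTheory GRing.Theory Num.Theory.

(** * Words up to commutation *)

Section Traces.
Variable Gamma : sgraph.
Local Notation letter := (Gamma * bool)%type.
Local Notation word := (seq letter).
Implicit Types (a b c : letter) (s t w : word).

Definition pairproj (u v : Gamma) w : word :=
  [seq l <- w | (l.1 == u) || (l.1 == v)].

(** Equality in the partially commutative monoid, expressed by projections so
    that cancelling a last letter and comparing last letters are immediate. *)
Definition same_trace w1 w2 :=
  forall u v, ~~ adj u v -> pairproj u v w1 = pairproj u v w2.

Definition inv_letter a : letter := (a.1, ~~ a.2).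

Lemma inv_letterK : involutive inv_letter.
Proof. by case=> u b; rewrite /inv_letter /= negbK. Qed.

Lemma pairproj_cat u v s t : pairproj u v (s ++ t) = pairproj u v s ++ pairproj u v t.
Proof. exact: filter_cat. Qed.

Lemma pairproj_rcons u v w a :
  pairproj u v (rcons w a) =
  if (a.1 == u) || (a.1 == v) then rcons (pairproj u v w) a else pairproj u v w.
Proof. exact: filter_rcons. Qed.

Lemma same_trace_sym w w' : same_trace w w' -> same_trace w' w.
Proof. by move=> h u v uv; rewrite h. Qed.

Lemma same_trace_trans w2 w1 w3 :
  same_trace w1 w2 -> same_trace w2 w3 -> same_trace w1 w3.
Proof. by move=> h1 h2 u v uv; rewrite h1 // h2. Qed.

Lemma same_trace_rcons w w' a :
  same_trace w w' -> same_trace (rcons w a) (rcons w' a).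
Proof. by move=> h u v uv; rewrite !pairproj_rcons h. Qed.

Lemma same_trace_rcons_inj w w' a :
  same_trace (rcons w a) (rcons w' a) -> same_trace w w'.
Proof.
move=> h u v uv; move: (h u v uv); rewrite !pairproj_rcons.
by case: ifP => // _ /rcons_inj [].
Qed.

Lemma adj_neq (u v : Gamma) : adj u v -> u != v.
Proof. by apply: contraL => /eqP ->; rewrite adj_irrefl. Qed.

Lemma same_trace_move s a t : all (fun l => adj a.1 l.1) t ->
  same_trace (s ++ a :: t) (rcons (s ++ t) a).
Proof.
move=> /allP at_ u v uv; rewrite pairproj_rcons !pairproj_cat /=.
have [a_uv|//] := boolP ((a.1 == u) || (a.1 == v)).
suff -> : pairproj u v t = [::] by rewrite cats0 cats1.
apply/eqP; rewrite -[_ == _]negbK -has_filter; apply/hasPn => l lt.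
apply: contra uv => luv; have al := at_ _ lt.
have := adj_neq al.
case/orP: a_uv => /eqP eu; case/orP: luv => /eqP el; move: al;
  rewrite eu el ?eqxx // => al _; by rewrite // adj_sym.
Qed.

(** A letter that closes every projection it occurs in can be carried to the
    end of the word: only letters adjacent to it stand after it. *)
Lemma last_letter w c :
  (forall v, ~~ adj c.1 v -> exists w', pairproj c.1 v w = rcons w' c) ->
  exists s t, w = s ++ c :: t /\ all (fun l => adj c.1 l.1) t.
Proof.
elim/last_ind: w => [|w d IH] h.
  by have [|[|? ?] //] := h c.1; rewrite adj_irrefl.
have [cd|ncd] := boolP (adj c.1 d.1).
  have [|s [t [-> ct]]] := IH.
    move=> v cv; have [w'] := h v cv; rewrite pairproj_rcons ifN; first by exists w'.
    rewrite negb_or eq_sym (adj_neq cd) /=.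
    by apply: contra cv => /eqP <-.
  by exists s, (rcons t d); rewrite -rcons_cons rcons_cat all_rcons /= cd.
have [w'] := h _ ncd; rewrite pairproj_rcons eqxx orbT => /rcons_inj [_ <-].
by exists w, [::]; rewrite cats1.
Qed.

Lemma ends_pairproj w w0 c : same_trace w (rcons w0 c) ->
  forall v, ~~ adj c.1 v -> exists w', pairproj c.1 v w = rcons w' c.
Proof.
move=> h v cv; exists (pairproj c.1 v w0).
by rewrite h // pairproj_rcons eqxx.
Qed.

(** Equal projections are realised by swaps of neighbouring commuting letters:
    the last letter of the first word can be carried to the end of the second,
    and then both can be cancelled. *)
Lemma same_trace_invariant (A : Type) (f : word -> A) :
  (forall s a b t, adj a.1 b.1 -> f (s ++ a :: b :: t) = f (s ++ b :: a :: t)) ->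
  forall w w', same_trace w w' -> f w = f w'.
Proof.
move=> f_swap w; elim/last_ind: w f f_swap => [|w a IH] f f_swap w' ww'.
  case: w' ww' => // l w' /(_ l.1 l.1); rewrite adj_irrefl => /(_ isT).
  by rewrite /pairproj /= eqxx.
have [s [t [w'E at_]]] := last_letter (ends_pairproj (same_trace_sym ww')).
have -> : f w' = f (rcons (s ++ t) a).
  rewrite w'E; elim: t s at_ {w'E} => [|l t IHt] s /=; first by rewrite cats0 cats1.
  by case/andP=> al at_; rewrite f_swap // -cat_rcons IHt // cat_rcons.
apply: (IH (fun x => f (rcons x a))) => [s' b c t' bc|].
  by rewrite !rcons_cat /= f_swap.
apply: (@same_trace_rcons_inj _ _ a); apply: same_trace_trans ww' _.
by rewrite w'E; exact: same_trace_move.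
Qed.

Definition ends w a := exists w0, same_trace w (rcons w0 a).

Lemma ends_same w w' a : same_trace w w' -> ends w a -> ends w' a.
Proof.
move=> ww' [w0 h]; exists w0; apply: same_trace_trans h.
exact: same_trace_sym.
Qed.

(** Two different possible last letters share no projection, so they commute
    and can both be stripped. *)
Lemma two_ends w w0 b c : same_trace (rcons w c) (rcons w0 b) ->
  (c = b /\ same_trace w w0) \/
  (adj c.1 b.1 /\
   exists2 w1, same_trace w (rcons w1 b) & same_trace w0 (rcons w1 c)).
Proof.
move=> h; have [cb|ncb] := boolP (adj c.1 b.1); last first.
  left; have := h _ _ ncb; rewrite !pairproj_rcons !eqxx orbT => /rcons_inj [_ cb].
  by split=> //; move: h; rewrite cb => /same_trace_rcons_inj.
right; split=> //.
have ne : forall v, ~~ adj b.1 v -> (c.1 == b.1) || (c.1 == v) = false.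
  move=> v bv; rewrite (negPf (adj_neq cb)) /=.
  by apply/negbTE; apply: contra bv => /eqP <-; rewrite adj_sym.
have ew v : ~~ adj b.1 v -> exists w', pairproj b.1 v w = rcons w' b.
  move=> bv; exists (pairproj b.1 v w0).
  by have := h _ _ bv; rewrite !pairproj_rcons ne // eqxx.
have [s [t [wE bt]]] := last_letter ew.
have wst : same_trace w (rcons (s ++ t) b).
  by rewrite wE; exact: same_trace_move.
exists (s ++ t) => //.
move=> u v uv; have := h _ _ uv; have := wst _ _ uv; rewrite !pairproj_rcons => ->.
case: ifP => cuv; case: ifP => buv // .
- have ncb := adj_neq cb; move: cb uv ncb.
  by case/orP: cuv => /eqP ->; case/orP: buv => /eqP ->; rewrite ?eqxx //;
    [move=> -> | rewrite adj_sym => ->].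
- by move/rcons_inj => [->].
Qed.

End Traces.

(** * Reduced words and the word problem *)

Section NormalForm.
Variable Gamma : sgraph.
Local Notation letter := (Gamma * bool)%type.
Local Notation word := (seq letter).
Implicit Types (a b c : letter) (s t w : word).

Lemma same_trace_swap_end w a b : adj a.1 b.1 ->
  same_trace (rcons (rcons w a) b) (rcons (rcons w b) a).
Proof.
move=> ab; rewrite -[rcons (rcons w a) b]cats1 cat_rcons -[rcons w b]cats1.
by apply: same_trace_move; rewrite /= ab.
Qed.

(** Reduced words are described by how they grow, which is the form needed to
    follow a deletion through the history of the word. *)
Inductive reduced : word -> Prop :=
| reduced_nil : reduced [::]
| reduced_rcons w a :
    reduced w -> ~ ends w (inv_letter a) -> reduced (rcons w a)
| reduced_same w w' : reduced w -> same_trace w w' -> reduced w'.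

(** Induction on the construction of [w]: either [b] was the last letter pushed,
    or the last letter pushed commutes with [b] and the two steps are
    interchanged. *)
Lemma reduced_pop w w0 b : reduced w -> same_trace w (rcons w0 b) ->
  reduced w0 /\ ~ ends w0 (inv_letter b).
Proof.
move=> rw; elim: rw w0 => {w} [|w a rw IH na|w w' _ IH ww'] w0 h.
- by have [[]] := ends_pairproj h (negbT (adj_irrefl b.1)).
- have [[ab ww0]|[ab [w1 h1 h2]]] := two_ends h.
    rewrite -ab; split; first exact: reduced_same rw ww0.
    by move=> e; apply: na; apply: ends_same e; exact: same_trace_sym.
  have [rw1 n1] := IH _ h1; split.
    apply: reduced_same (same_trace_sym h2); apply: reduced_rcons => // -[w2 e].
    apply: na; exists (rcons w2 b).
    apply: same_trace_trans h1 _; apply: same_trace_trans (same_trace_rcons b e) _.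
    exact: same_trace_swap_end.
  move=> [w2 e]; apply: n1.
  have /two_ends[[ca _]|[_ [w3 e3 _]]] :=
    same_trace_trans (same_trace_sym h2) e; last by exists w3.
  by rewrite ca adj_irrefl in ab.
- by apply: IH; exact: same_trace_trans ww' h.
Qed.

(** Right multiplication by a letter. The word [w0] chosen when the inverse
    letter is removed is unique up to [same_trace]. *)
Definition act w a : word :=
  if pselect (ends w (inv_letter a)) is left e then projT1 (cid e) else rcons w a.

Variant act_spec w a : word -> Prop :=
| ActPop w0 of same_trace w (rcons w0 (inv_letter a)) : act_spec w a w0
| ActPush of ~ ends w (inv_letter a) : act_spec w a (rcons w a).

Lemma actP w a : act_spec w a (act w a).
Proof.
rewrite /act; case: pselect => [e|ne]; last exact: ActPush.
by case: (cid e) => w0 h; exact: ActPop.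
Qed.

Lemma act_reduced w a : reduced w -> reduced (act w a).
Proof.
move=> rw; case: actP => [w0 h|na]; first by case: (reduced_pop rw h).
exact: reduced_rcons.
Qed.

Lemma act_same w w' a : same_trace w w' -> same_trace (act w a) (act w' a).
Proof.
move=> ww'; case: actP => [w0 h|n]; case: actP => [w0' h'|n'].
- apply: (@same_trace_rcons_inj _ _ _ (inv_letter a)).
  exact: same_trace_trans (same_trace_sym h) (same_trace_trans ww' h').
- by case: n'; apply: (ends_same ww'); exists w0.
- by case: n; apply: (ends_same (same_trace_sym ww')); exists w0'.
- exact: same_trace_rcons.
Qed.

Lemma act_inv w a : reduced w -> same_trace (act (act w a) (inv_letter a)) w.
Proof.
move=> rw; case: (actP w a) => [w0 h|n].
  have [_] := reduced_pop rw h; case: actP => [w1 h1|_ _].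
    by case; exists w1; exact: h1.
  exact: same_trace_sym.
case: actP => [w0|[]]; rewrite inv_letterK; last by exists w.
by move/same_trace_rcons_inj/same_trace_sym.
Qed.

Lemma ends_rcons_adj w a b : adj a.1 b.1 -> ends (rcons w a) b <-> ends w b.
Proof.
move=> ab; split=> [[w0 /two_ends[[ca _]|[_ [w3 e3 _]]]]|[w0 e]].
- by rewrite ca adj_irrefl in ab.
- by exists w3.
exists (rcons w0 a); apply: same_trace_trans (same_trace_rcons a e) _.
by apply: same_trace_swap_end; rewrite adj_sym.
Qed.

(** Adjacent letters occur in no common projection, so whether one of them is
    pushed or popped does not depend on the other. *)
Lemma act_commute w a b : adj a.1 b.1 ->
  same_trace (act (act w a) b) (act (act w b) a).
Proof.
move=> ab; have ba : adj b.1 a.1 by rewrite adj_sym.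
case: (actP w a) => [wa ha|na]; case: (actP w b) => [wb hb|nb].
- have /two_ends[[ca _]|[_ [w1 e1 e2]]] := same_trace_trans (same_trace_sym ha) hb.
    by move: ab; rewrite -[a.1]/((inv_letter a).1) ca adj_irrefl.
  case: actP => [v h|[]]; last by exists w1.
  case: actP => [v' h'|[]]; last by exists w1.
  apply: (@same_trace_trans _ w1).
    apply: (@same_trace_rcons_inj _ _ _ (inv_letter b)).
    exact: same_trace_trans (same_trace_sym h) e1.
  apply: (@same_trace_rcons_inj _ _ _ (inv_letter a)).
  exact: same_trace_trans (same_trace_sym e2) h'.
- have nb' : ~ ends wa (inv_letter b).
    move=> e; apply: nb; apply: (ends_same (same_trace_sym ha)).
    by apply/ends_rcons_adj.
  case: actP => [v h|_]; first by case: nb'; exists v.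
  have hb : same_trace (rcons w b) (rcons (rcons wa b) (inv_letter a)).
    apply: same_trace_trans (same_trace_rcons b ha) _.
    exact: same_trace_swap_end.
  case: actP => [v h|[]]; last by exists (rcons wa b).
  apply: (@same_trace_rcons_inj _ _ _ (inv_letter a)).
  exact: same_trace_trans (same_trace_sym hb) h.
- have na' : ~ ends wb (inv_letter a).
    move=> e; apply: na; apply: (ends_same (same_trace_sym hb)).
    by apply/ends_rcons_adj.
  case: (actP wb) => [v h|_]; first by case: na'; exists v.
  have ha : same_trace (rcons w a) (rcons (rcons wb a) (inv_letter b)).
    apply: same_trace_trans (same_trace_rcons a hb) _.
    exact: same_trace_swap_end.
  case: actP => [v h|[]]; last by exists (rcons wb a).
  apply: (@same_trace_rcons_inj _ _ _ (inv_letter b)).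
  exact: same_trace_trans (same_trace_sym h) ha.
- case: actP => [v h|_]; first by case: nb;
    apply/(@ends_rcons_adj w a (inv_letter b) ab); exists v.
  case: actP => [v h|_]; first by case: na;
    apply/(@ends_rcons_adj w b (inv_letter a) ba); exists v.
  exact: same_trace_swap_end.
Qed.

Definition normal_form w : word := foldl act [::] w.

Lemma foldl_act_same w w' s : same_trace w w' ->
  same_trace (foldl act w s) (foldl act w' s).
Proof. by elim: s w w' => //= a s IH w w' h; apply/IH/act_same. Qed.

Lemma foldl_act_reduced w s : reduced w -> reduced (foldl act w s).
Proof. by elim: s w => //= a s IH w h; apply/IH/act_reduced. Qed.

(** The solution of the word problem: the letters act on reduced words, up to
    [same_trace], in a way that satisfies the defining relations. *)
Lemma normal_form_same u v : pres_eqv (raag_relators Gamma) u v ->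
  same_trace (normal_form u) (normal_form v).
Proof.
have red_nf w : reduced (normal_form w) by exact/foldl_act_reduced/reduced_nil.
elim=> {u v} [//|u v _ /same_trace_sym//|u v w _ h1 _ h2|u v x b|u r v].
- exact: same_trace_trans h1 h2.
- rewrite /normal_form !foldl_cat /=; apply: foldl_act_same.
  exact: (@act_inv _ (x, b)).
move=> [x [y [xy ->]]]; rewrite /normal_form !foldl_cat /=; apply: foldl_act_same.
set w := foldl act [::] u; have rw : reduced w by exact: red_nf.
rewrite -[(x, true)]/(inv_letter (x, false)).
rewrite -[(y, true)]/(inv_letter (y, false)).
apply: same_trace_trans (act_inv (y, false) rw); apply: act_same.
apply: same_trace_trans (act_inv (x, false) (act_reduced (y, false) rw)).
by apply: act_same; exact: act_commute.
Qed.

Local Notation pi := (pres_pi (raag_relators Gamma)).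

Lemma pi_cat u v : pi (u ++ v) = (pi u * pi v)%g.
Proof. by rewrite -pres_piM. Qed.

Lemma pi_nil : pi [::] = 1%g.
Proof. by []. Qed.

Lemma pi_rcons u a : pi (rcons u a) = (pi u * pi [:: a])%g.
Proof. by rewrite -cats1 pi_cat. Qed.

Lemma pi_cons a u : pi (a :: u) = (pi [:: a] * pi u)%g.
Proof. by rewrite -pi_cat. Qed.

Lemma pi_inv_letter a : pi [:: inv_letter a] = (pi [:: a])^-1%g.
Proof. by rewrite [RHS]pres_piV. Qed.

Lemma pi_fword_inv u : pi (fword_inv u) = (pi u)^-1%g.
Proof. by rewrite [RHS]pres_piV. Qed.

Lemma pi_commute a b : adj a.1 b.1 -> commute (pi [:: a]) (pi [:: b]).
Proof.
case: a b => [u e] [v f] /= uv.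
have piT (x : Gamma) : pi [:: (x, true)] = (pi [:: (x, false)])^-1%g.
  by rewrite -pi_inv_letter.
have c : commute (pi [:: (u, false)]) (pi [:: (v, false)]).
  have : pi [:: (u, false); (v, false); (u, true); (v, true)] = pi [::].
    apply/pres_piP.
    have rr : raag_relators Gamma [:: (u, false); (v, false); (u, true); (v, true)].
      by exists u, v.
    exact: pres_relator [::] _ [::] rr.
  rewrite pi_cons (pi_cons (v, _)) (pi_cons (u, true)) !piT pi_nil.
  rewrite !mulgA => /divg1_eq e1.
  by rewrite /commute -[in RHS]e1 mulgVK.
have cV (x y : raag Gamma) : commute x y -> commute x^-1%g y.
  by move=> xy; apply/commute_sym/commuteV/commute_sym.
by case: e; case: f; rewrite ?piT //;
  [apply: cV; apply: commuteV | apply: cV | apply: commuteV].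
Qed.

Lemma pi_swap s a b t : adj a.1 b.1 ->
  pi (s ++ a :: b :: t) = pi (s ++ b :: a :: t).
Proof.
move=> ab; rewrite !pi_cat; congr (_ * _)%g.
rewrite (pi_cons a (b :: t)) (pi_cons b t) (pi_cons b (a :: t)) (pi_cons a t).
rewrite !mulgA; congr (_ * _)%g.
exact: pi_commute.
Qed.

Lemma pi_same w w' : same_trace w w' -> pi w = pi w'.
Proof. by apply: same_trace_invariant => s a b t; exact: pi_swap. Qed.

Lemma pi_act w a : pi (act w a) = (pi w * pi [:: a])%g.
Proof.
case: actP => [w0 h|_]; last exact: pi_rcons.
by rewrite (pi_same h) pi_rcons pi_inv_letter mulgVK.
Qed.

Lemma pi_normal_form w : pi (normal_form w) = pi w.
Proof.
rewrite /normal_form -[RHS]mul1g -pi_nil.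
elim: w [::] => [|a w IH] s /=; first by rewrite -pi_cat cats0.
by rewrite IH pi_act -mulgA -pi_cons.
Qed.

Definition word_of (x : raag Gamma) : word := normal_form (repr x).

Lemma pi_word_of x : pi (word_of x) = x.
Proof. by rewrite /word_of pi_normal_form /pres_pi reprK. Qed.

(** Neighbours in the Cayley graph have words of which one extends the other by
    a single letter. *)
Lemma word_of_step x a :
  let y := (x * pi [:: a])%g in
  same_trace (word_of y) (rcons (word_of x) a) \/
  same_trace (word_of x) (rcons (word_of y) (inv_letter a)).
Proof.
move=> y.
have : same_trace (word_of y) (act (word_of x) a).
  rewrite /word_of -[act _ a]/(foldl act (normal_form (repr x)) [:: a]).
  rewrite -foldl_cat; apply: normal_form_same; apply/pres_piP.
  by rewrite pi_cat /pres_pi !reprK.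
case: actP => [w0 h yw0|_ h]; [right|by left].
by apply: same_trace_trans h _; apply/same_trace_rcons/same_trace_sym.
Qed.

End NormalForm.

(** * Chips on the blocks of a word *)

Section Chips.
Variables (Gamma : sgraph) (L : nat).
Hypothesis L_gt0 : 0 < L.
Local Notation letter := (Gamma * bool)%type.
Local Notation word := (seq letter).
Implicit Types (a : letter) (w : word) (u v x : Gamma) (n : Gamma -> nat).

Definition occ v w := count (fun l : letter => l.1 == v) w.

(** Occurrences are numbered from 0, and an occurrence of [v] that does not exist
    counts as the end of the word. *)
Fixpoint before u v j w : nat :=
  if w is l :: w' then
    if l.1 == v then (if j is j'.+1 then before u v j' w' else 0)
    else (l.1 == u) + before u v j w'
  else 0.

Fixpoint position v j w : nat :=
  if w is l :: w' then
    if l.1 == v then (if j is j'.+1 then (position v j' w').+1 else 0)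
    else (position v j w').+1
  else 0.

Lemma occ_rcons v w a : occ v (rcons w a) = occ v w + (a.1 == v).
Proof. by rewrite /occ -cats1 count_cat /= addn0. Qed.

Lemma occ_pairproj v w : occ v w = size (pairproj v v w).
Proof. by rewrite size_filter; apply: eq_count => l; rewrite orbb. Qed.

Lemma before_pairproj u v j w : before u v j (pairproj u v w) = before u v j w.
Proof.
elim: w j => //= l w IH j.
case: (eqVneq l.1 v) => [lv|lv] /=; first by rewrite orbT /= lv eqxx; case: j.
by rewrite orbF; case: eqVneq => [lu|lu] /=; rewrite ?(negPf lv) IH // lu eqxx.
Qed.

Lemma before_le u v j w : u != v -> before u v j w <= occ u w.
Proof.
move=> uv; elim: w j => //= l w IH j.
case: (eqVneq l.1 v) => [->|_]; last by rewrite leq_add2l.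
by case: j => [|j] //; rewrite (leq_trans (IH j)) // leq_addl.
Qed.

Lemma before_mono u v j k w : j <= k -> before u v j w <= before u v k w.
Proof.
elim: w j k => //= l w IH j k jk.
case: eqP => _; last by rewrite leq_add2l IH.
by case: j k jk => [|j] [|k] // jk; rewrite IH.
Qed.

Lemma before_rcons u v j w a :
  j < occ v w -> before u v j (rcons w a) = before u v j w.
Proof.
elim: w j => //= l w IH j; case: eqP => _ jw; last by rewrite IH.
by case: j jw => // j jw; rewrite IH.
Qed.

Lemma before_total u v i j w : u != v -> i < occ u w -> j < occ v w ->
  i < before u v j w \/ j < before v u i w.
Proof.
move=> uv; elim: w i j => //= l w IH i j.
case: (eqVneq l.1 u) => [->|lu]; rewrite ?(negPf uv).
  case: i => [|i] hi hj; first by left.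
  by have [|] := IH i j hi hj; [left|right].
case: (eqVneq l.1 v) => [_|lv] hi hj; last exact: IH.
case: j hj => [|j] hj; first by right.
by have [|] := IH i j hi hj; [left|right].
Qed.

Lemma before_position u v i j w : u != v -> i < before u v j w ->
  position u i w < position v j w.
Proof.
move=> uv; elim: w i j => //= l w IH i j.
case: (eqVneq l.1 v) => [lv|lv].
  by rewrite lv eq_sym (negPf uv); case: j => // j /IH.
case: (eqVneq l.1 u) => [_|lu]; last by move/IH.
by case: i => [|i] //; rewrite add1n ltnS => /IH.
Qed.

(** Rounded up quotient: the number of blocks of size [L] needed for [m]
    occurrences. Block number [k] starts at occurrence [k * L]. *)
Definition blocks m := (m + L.-1) %/ L.

Lemma blocks_mono m k : m <= k -> blocks m <= blocks k.
Proof. by move=> mk; rewrite leq_div2r // leq_add2r. Qed.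

Lemma ltn_blocks j m : (j < blocks m) = (j * L < m).
Proof.
rewrite /blocks leq_divRL // mulSn -[RHS](ltn_add2r L.-1) -addnS prednK //.
by rewrite addnC.
Qed.

Lemma leq_blocks m : m <= blocks m * L.
Proof. by rewrite leqNgt -ltn_blocks ltnn. Qed.

Lemma blocks_lt m : blocks m * L < m + L.
Proof.
rewrite -[L in ltnRHS](prednK L_gt0) addnS ltnS.
exact: leq_divM.
Qed.

(** With [m] chips on [v], the last one lies in the block that starts at
    occurrence [(m - 1) %/ L * L]; this is the capacity of the blocks of [u]
    whose first occurrence comes before that one in [w]. *)
Definition demand w u v m :=
  if m is m'.+1 then blocks (before u v (m' %/ L * L) w) * L else 0.

Lemma demand_mono w u v m : demand w u v m <= demand w u v m.+1.
Proof.
case: m => // m; rewrite /= leq_mul2r; apply/orP; right.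
by apply/blocks_mono/before_mono; rewrite leq_mul2r leq_div2r ?orbT.
Qed.

Definition pour w (e : Gamma * Gamma) n : Gamma -> nat :=
  if n e.1 < demand w e.1 e.2 (n e.2) then
    fun x => if x == e.1 then (n x).+1 else if x == e.2 then (n x).-1 else n x
  else n.

Definition add_chip n x : Gamma -> nat := fun y => n y + (y == x).

(** The key to the Lipschitz estimate: a move behaves like a comparator of a
    sorting network. As [demand] is nondecreasing, an extra chip either leaves
    the decision to move unchanged or reverses it, and in the second case the
    two results still differ by one chip. *)
Lemma pour_add_chip w e n x : e.1 != e.2 ->
  exists y, pour w e (add_chip n x) = add_chip (pour w e n) y.
Proof.
case: e => u v /= uv; have vu : v != u by rewrite eq_sym.
rewrite /pour /add_chip /=.
have [->|xu] := eqVneq x u.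
  rewrite ?eqxx (negPf vu) addn0 addn1.
  have [lt|ge] := ltnP (n u).+1 (demand w u v (n v)).
    rewrite ltnW //; exists u; apply/funext => y.
    by case: eqVneq => _; rewrite ?addn1 ?addn0.
  have [lt|ge'] := ltnP (n u) (demand w u v (n v)); last by exists u.
  exists v; apply/funext => y; case: (eqVneq y u) => [->|yu].
    by rewrite (negPf uv) addn1 addn0.
  case: eqVneq => [->|_]; rewrite ?addn0 ?addn1 // prednK //.
  by case: (n v) lt.
rewrite ?[u == x]eq_sym ?(negPf xu) addn0.
have [->|xv] := eqVneq x v.
  rewrite ?eqxx addn1.
  have [lt|ge] := ltnP (n u) (demand w u v (n v)).
    rewrite (leq_trans lt) ?demand_mono //.
    exists v; apply/funext => y; case: (eqVneq y u) => [->|yu].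
      by rewrite (negPf uv) !addn0.
    by case: eqVneq => [->|_]; rewrite ?addn0 // !addn1 /= prednK //; case: (n v) lt.
  case: ltnP => lt; last by exists v.
  exists u; apply/funext => y; case: (eqVneq y u) => [->|yu].
    by rewrite (negPf uv) addn1 addn0.
  by case: eqVneq => [->|_]; rewrite ?addn0 ?addn1.
rewrite ?[v == x]eq_sym ?(negPf xv) addn0; exists x.
case: ifP => // _; apply/funext => y.
case: (eqVneq y u) => [->|_]; first by rewrite eq_sym (negPf xu) !addn0.
by case: (eqVneq y v) => [->|_] //; rewrite eq_sym (negPf xv) !addn0.
Qed.

Lemma sum_pour w e n : e.1 != e.2 -> \sum_v pour w e n v = \sum_v n v.
Proof.
case: e => u v /= uv; have vu : v != u by rewrite eq_sym.
rewrite /pour /=; case: ifP => // lt.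
rewrite (bigD1 u) //= (bigD1 v) //= [RHS](bigD1 u) //= [in RHS](bigD1 v) //=.
rewrite !eqxx (negPf vu) !addnA.
congr (_ + _); first by case: (n v) lt => //= k _; rewrite addSnnS.
by apply: eq_bigr => x /andP[/negPf -> /negPf ->].
Qed.

(** Each chip contributes the position in [w] of the start of its block; a move
    sends a chip to a block that starts earlier. *)
Definition potential w n :=
  \sum_v \sum_(0 <= k < n v) position v (k %/ L * L) w.

Lemma pour_potential w e n : e.1 != e.2 ->
  pour w e n = n \/ potential w (pour w e n) < potential w n.
Proof.
case: e => u v /= uv; have vu : v != u by rewrite eq_sym.
rewrite /pour /=; case: ifP => [lt|]; [right|by left].
rewrite /potential (bigD1 u) //= (bigD1 v) //= [ltnRHS](bigD1 u) //=.
rewrite [in ltnRHS](bigD1 v) //= !eqxx (negPf vu) !addnA.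
case: (n v) lt => //= m lt; rewrite !big_nat_recr //=.
rewrite (eq_bigr (fun x => \sum_(0 <= k < n x) position x (k %/ L * L) w)); last first.
  by move=> x /andP[/negPf -> /negPf ->].
rewrite ltn_add2r -!addnA ltn_add2l addnC ltn_add2l.
by apply: before_position => //; rewrite -ltn_blocks ltn_divLR.
Qed.

Definition pairs : seq (Gamma * Gamma) :=
  [seq e <- enum {: Gamma * Gamma} | ~~ adj e.1 e.2 && (e.1 != e.2)].

Lemma mem_pairs e : (e \in pairs) = ~~ adj e.1 e.2 && (e.1 != e.2).
Proof. by rewrite mem_filter mem_enum andbT. Qed.

Definition pour_all w (s : seq (Gamma * Gamma)) n := foldl (fun n e => pour w e n) n s.

Lemma pour_all_ind (P : (Gamma -> nat) -> Prop) w s n :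
  {in s, forall e n, P n -> P (pour w e n)} -> P n -> P (pour_all w s n).
Proof.
elim: s n => //= e s IH n h Pn; apply: IH; last by apply: h; rewrite ?mem_head.
by move=> e' es; apply: h; rewrite inE es orbT.
Qed.

Lemma pour_all_potential w s n : {in s, forall e, e.1 != e.2} ->
  {in s, forall e, pour w e n = n} \/ potential w (pour_all w s n) < potential w n.
Proof.
elim: s n => [|e s IH] n h; first by left.
have hs : {in s, forall e, e.1 != e.2} by move=> e' es; apply: h; rewrite inE es orbT.
have he := h e (mem_head _ _).
have [fixs|lts] := IH (pour w e n) hs; have [fixe|lte] := pour_potential w n he.
- left=> e'; rewrite inE => /predU1P[->//|es].
  by rewrite -[in LHS]fixe fixs.
- right; suff -> : pour_all w (e :: s) n = pour w e n by [].
  rewrite /pour_all /=; elim: s {IH h hs} fixs => //= e' s IH fixs.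
  rewrite (fixs _ (mem_head _ _)) IH // => e'' es.
  by apply: fixs; rewrite inE es orbT.
- by right; rewrite /= -[in ltnRHS]fixe.
- by right; apply: ltn_trans lte.
Qed.

Definition stable w n := {in pairs, forall e, pour w e n = n}.

Lemma stable_pour_all w n : stable w n -> pour_all w pairs n = n.
Proof.
rewrite /stable; elim: pairs => //= e s IH h.
rewrite h ?mem_head // IH // => e' es; apply: h; by rewrite inE es orbT.
Qed.

Lemma stable_iter w n t : potential w n <= t -> stable w (iter t (pour_all w pairs) n).
Proof.
have pr : {in pairs, forall e, e.1 != e.2} by move=> e; rewrite mem_pairs => /andP[].
elim: t n => [|t IH] n pt.
  by have [//|] := pour_all_potential w n pr; move: pt; rewrite leqn0 => /eqP ->.
rewrite iterSr; have [st|lt] := pour_all_potential w n pr.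
  have -> : iter t (pour_all w pairs) (pour_all w pairs n) = n.
    by rewrite -iterSr; elim: t.+1 => //= k ->; exact: stable_pour_all.
  exact: st.
by apply: IH; rewrite -ltnS (leq_trans lt).
Qed.

Definition start w : Gamma -> nat := fun v => occ v w.

(** The stable configuration reached from one chip for each letter. Pouring in a
    fixed order makes it a function of the word, and in fact of its
    projections. *)
Definition settle w := iter (potential w (start w)) (pour_all w pairs) (start w).

(** Any sufficiently long run gives the same result, so runs for two words can be
    compared over a common time. *)
Lemma settle_iter w t : potential w (start w) <= t ->
  iter t (pour_all w pairs) (start w) = settle w.
Proof.
move=> pt; rewrite -(subnK pt) iterD -/(settle w).
have st : stable w (settle w) by exact: stable_iter.
by elim: (t - _) => //= k ->; exact: stable_pour_all.
Qed.

Lemma settle_ind (P : (Gamma -> nat) -> Prop) w :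
  {in pairs, forall e n, P n -> P (pour w e n)} -> P (start w) -> P (settle w).
Proof.
move=> h P0; rewrite /settle; elim: (potential _ _) => //= k IH.
exact: pour_all_ind.
Qed.

Lemma settle_stable w : stable w (settle w).
Proof. exact: stable_iter. Qed.

Lemma sum_settle w : \sum_v settle w v = \sum_v occ v w.
Proof.
apply: (@settle_ind (fun n => \sum_v n v = \sum_v occ v w)) => // e.
by rewrite mem_pairs => /andP[_ e12] n <-; exact: sum_pour.
Qed.

Definition capped w n := forall v, n v <= blocks (occ v w) * L.

Lemma pour_capped w e n : e.1 != e.2 -> capped w n -> capped w (pour w e n).
Proof.
case: e => u v /= uv cn x; rewrite /pour /=; case: ifP => //= lt.
case: eqVneq => [->|_]; last first.
  by case: eqVneq => // _; rewrite (leq_trans (leq_pred _)).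
rewrite (leq_trans lt) //; case: (n v) => //= m.
by rewrite leq_mul2r blocks_mono ?orbT ?before_le.
Qed.

Lemma start_capped w : capped w (start w).
Proof. by move=> v; exact: leq_blocks. Qed.

Lemma settle_capped w : capped w (settle w).
Proof.
apply: (@settle_ind (capped w)); last exact: start_capped.
by move=> e; rewrite mem_pairs => /andP[_ ?] n; exact: pour_capped.
Qed.

Lemma settle_same w w' : same_trace w w' -> settle w = settle w'.
Proof.
move=> ww'.
have occE : start w = start w'.
  by apply/funext => v; rewrite /start !occ_pairproj ww' // adj_irrefl.
have pourE : {in pairs, forall e, pour w e = pour w' e}.
  move=> e; rewrite mem_pairs => /andP[ne _]; apply/funext => n.
  rewrite /pour; suff -> : demand w e.1 e.2 = demand w' e.1 e.2 by [].
  apply/funext => -[//|m] /=.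
  by rewrite -before_pairproj ww' // before_pairproj.
have passE : pour_all w pairs = pour_all w' pairs.
  apply/funext => n; rewrite /pour_all.
  elim: pairs n pourE => //= e s IH n h.
  rewrite h ?mem_head // IH // => e' es; apply: h; by rewrite inE es orbT.
pose t := maxn (potential w (start w)) (potential w' (start w')).
rewrite -(@settle_iter w t) ?leq_maxl // -(@settle_iter w' t) ?leq_maxr //.
by rewrite passE occE.
Qed.

(** Both configurations evolve under the same demands: from [w] no chip reaches
    a block that begins after the last occurrence of its vertex, and on the
    other blocks the new letter does not change [demand]. *)
Lemma settle_rcons w a : exists x, settle (rcons w a) = add_chip (settle w) x.
Proof.
pose t := maxn (potential w (start w)) (potential (rcons w a) (start (rcons w a))).
rewrite -(@settle_iter w t) ?leq_maxl // -(@settle_iter (rcons w a) t) ?leq_maxr //.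
pose P n' n := capped w n /\ exists x, n' = add_chip n x.
suff [] : P (iter t (pour_all (rcons w a) pairs) (start (rcons w a)))
            (iter t (pour_all w pairs) (start w)) by [].
have demandE e n : capped w n ->
    demand (rcons w a) e.1 e.2 (n e.2) = demand w e.1 e.2 (n e.2).
  move=> cn; have := cn e.2; case: (n e.2) => //= m mlt.
  rewrite before_rcons // -ltn_blocks ltn_divLR //.
have step s n' n : {in s, forall e, e.1 != e.2} -> P n' n ->
    P (pour_all (rcons w a) s n') (pour_all w s n).
  elim: s n' n => //= e s IH n' n hs [cn [x ->]].
  apply: IH => [e' es|]; first by apply: hs; rewrite inE es orbT.
  split; first by apply: pour_capped => //; rewrite hs ?mem_head.
  have [y ->] := pour_add_chip (rcons w a) n x (hs _ (mem_head _ _)).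
  by exists y; rewrite /pour demandE.
have : P (start (rcons w a)) (start w).
  split; first exact: start_capped.
  by exists a.1; apply/funext => v; rewrite /start /add_chip occ_rcons eq_sym.
elim: t => //= k IH P0; apply: step; last exact: IH.
by move=> e; rewrite mem_pairs => /andP[].
Qed.

(** If [u] and [v] do not commute, the starts of any two of their blocks are
    ordered by [w]; when both top blocks are partially filled, the later one
    could still pour into the earlier one. *)
Lemma fractional_adj w u v : u != v ->
  ~~ (L %| settle w u) -> ~~ (L %| settle w v) -> adj u v.
Proof.
suff key x y : x != y -> ~~ adj x y -> ~~ (L %| settle w x) -> ~~ (L %| settle w y) ->
    settle w x %/ L * L < before x y (settle w y %/ L * L) w -> False.
  move=> uv Lu Lv; apply/negPn/negP => nuv.
  have small x : ~~ (L %| settle w x) -> settle w x %/ L * L < occ x w.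
    move=> Lx; rewrite -ltn_blocks ltn_divLR // ltn_neqAle settle_capped andbT.
    by apply: contra Lx => /eqP ->; exact: dvdn_mull.
  have [] := before_total uv (small _ Lu) (small _ Lv); first exact: key.
  by apply: key => //; rewrite 1?eq_sym // adj_sym.
move=> xy nxy Lx Ly lt.
have := @settle_stable w (x, y); rewrite mem_pairs /= nxy xy => /(_ isT).
rewrite /pour /=; case: ifP => [_ /(congr1 (fun f => f x))|/negbT + _].
  by rewrite /= eqxx => /eqP; rewrite eqn_leq ltnn.
rewrite -leqNgt => /(leq_trans _) => /(_ (settle w x).+1); rewrite ltnn => h.
suff : false by []; apply: h.
have : 0 < settle w y by rewrite lt0n; apply: contra Ly => /eqP ->.
case E : (settle w y) => [//|m] _ /=.
have -> : m %/ L = settle w y %/ L.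
  by rewrite E divnS // -E (negPf Ly).
by rewrite -ltn_divLR // ltn_blocks.
Qed.

End Chips.

(** * Truncations *)

Section Layers.
Variables (Gamma : sgraph) (L : nat).
Hypothesis L_gt0 : 0 < L.
Local Notation letter := (Gamma * bool)%type.
Local Notation word := (seq letter).
Local Notation pi := (pres_pi (raag_relators Gamma)).
Implicit Types (a b l : letter) (w : word) (u v x : Gamma).
Implicit Types (q n : Gamma -> nat).

(** The letters of [w] that must be kept in a prefix containing the first [q v]
    occurrences of each [v]: these occurrences, and every letter blocked by a
    kept letter on its right. *)
Fixpoint down_closure q w : word :=
  if w is l :: w' then
    let k := down_closure (fun v => q v - (v == l.1)) w' in
    if (0 < q l.1) || ~~ all (fun m : letter => adj l.1 m.1) k then l :: k else k
  else [::].

Lemma pi_down_closure_swap q s a b t : adj a.1 b.1 ->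
  pi (down_closure q (s ++ a :: b :: t)) = pi (down_closure q (s ++ b :: a :: t)).
Proof.
move=> ab; have nab := adj_neq ab.
suff : down_closure q (s ++ a :: b :: t) = down_closure q (s ++ b :: a :: t) \/
    exists s' t', down_closure q (s ++ a :: b :: t) = s' ++ a :: b :: t' /\
                  down_closure q (s ++ b :: a :: t) = s' ++ b :: a :: t'.
  by case=> [->//|[s' [t' [-> ->]]]]; exact: pi_swap.
elim: s q => [|l s IH] q /=.
  have -> : (fun v => q v - (v == b.1) - (v == a.1)) =
            (fun v => q v - (v == a.1) - (v == b.1)).
    by apply/funext => v; rewrite subnAC.
  rewrite (negPf nab) eq_sym (negPf nab) !subn0.
  set k := down_closure _ t.
  have [ca|ca] := boolP ((0 < q a.1) || ~~ all (fun m => adj a.1 m.1) k);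
  have [cb|cb] := boolP ((0 < q b.1) || ~~ all (fun m => adj b.1 m.1) k);
    rewrite /= ?ab ?[adj b.1 a.1]adj_sym ?ab /= ?(negPf ca) ?(negPf cb) ?ca ?cb;
    [|by left..].
  by right; exists [::], k.
have [->|[s' [t' [-> ->]]]] := IH (fun v => q v - (v == l.1)); first by left.
have -> : all (fun m => adj l.1 m.1) (s' ++ b :: a :: t') =
          all (fun m => adj l.1 m.1) (s' ++ a :: b :: t').
  by rewrite !all_cat /=; congr andb; rewrite andbCA.
by right; case: ifP => _; [exists (l :: s'), t'|exists s', t'].
Qed.

Lemma pi_down_closure_same q w w' : same_trace w w' ->
  pi (down_closure q w) = pi (down_closure q w').
Proof.
apply: (same_trace_invariant (f := fun z => pi (down_closure q z))).
by move=> s a b t; exact: pi_down_closure_swap.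
Qed.

Lemma down_closure_rcons q w a : q a.1 <= occ a.1 w ->
  down_closure q (rcons w a) = down_closure q w.
Proof.
elim: w q => [|l w IH] q /=; first by rewrite leqn0 => /eqP ->.
by rewrite eq_sym => qa; rewrite IH // leq_subLR.
Qed.

Lemma pi_commute_all l w : all (fun m : letter => adj l.1 m.1) w ->
  commute (pi [:: l]) (pi w).
Proof.
elim: w => [_|m w IH /= /andP[lm lw]].
  by rewrite pi_nil; exact: commute1.
by rewrite (pi_cons m w); apply: commuteM; [exact: pi_commute|exact: IH].
Qed.

(** A dropped letter commutes with all the kept letters after it, so it can be
    carried to the end. *)
Lemma down_closure_prefix q w : exists r,
  pi w = (pi (down_closure q w) * pi r)%g /\ size r <= \sum_v (occ v w - q v).
Proof.
elim: w q => [|l w IH] q /=; first by exists [::]; rewrite pi_nil mulg1.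
have [r [e sr]] := IH (fun v => q v - (v == l.1)).
set k := down_closure _ w in e *.
have [_|] := boolP ((0 < q l.1) || ~~ all (fun m : letter => adj l.1 m.1) k).
  exists r; split; first by rewrite pi_cons e mulgA -pi_cons.
  apply: leq_trans sr _; apply: leq_sum => v _.
  rewrite [l.1 == v]eq_sym; case: (v == l.1); rewrite ?subn0 //.
  by rewrite subn1 add1n; case: (q v) => [|m]; rewrite ?subn0 ?leqnSn // subSS.
rewrite negb_or negbK -eqn0Ngt => /andP[/eqP ql0 lk].
exists (l :: r); split.
  rewrite pi_cons e mulgA (pi_commute_all lk).
  by rewrite -mulgA -pi_cons.
rewrite (bigD1 l.1) //= eqxx ql0 subn0 add1n ltnS.
apply: leq_trans sr _; rewrite (bigD1 l.1) //= ql0 subn0 leq_add2l.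
by apply: leq_sum => v /negPf vl; rewrite [l.1 == v]eq_sym vl subn0 add0n.
Qed.

(** The number of blocks of [v] that hold at least [i] chips, for [0 < i <= L]. *)
Definition layer n i v := (n v + L - i) %/ L.

(** One block less than [layer], so that all the occurrences asked for exist even
    if the top block is only partly present in the word. *)
Definition threshold n i v := (layer n i v).-1 * L.

Definition truncation w i : raag Gamma :=
  pi (down_closure (threshold (settle L w) i) w).

Lemma truncation_same w w' i : same_trace w w' ->
  truncation w i = truncation w' i.
Proof.
by move=> ww'; rewrite /truncation (settle_same L_gt0 ww') (pi_down_closure_same _ ww').
Qed.

Lemma layerE n i v : 0 < i <= L ->
  layer n i v = n v %/ L + (i <= n v %% L).
Proof.
case/andP=> i0 iL; rewrite /layer {1}(divn_eq (n v) L) -addnA -addnBA; last first.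
  by rewrite (leq_trans iL) // leq_addl.
rewrite divnMDl //; congr addn.
have rL : n v %% L < L by rewrite ltn_mod.
case: leqP => ir /=.
  rewrite -addnBAC // divnDr ?dvdnn // divnn L_gt0 divn_small //.
  by rewrite (leq_ltn_trans _ rL) // leq_subr.
by rewrite divn_small // ltn_subLR ?ltn_add2r // (leq_trans iL) ?leq_addl.
Qed.

(** The extra chip completes a level [i] of one block for a single [i]; for the
    others the threshold is unchanged and does not reach the new letter. *)
Lemma truncation_rcons w a : exists i0, forall i, 0 < i <= L -> i != i0 ->
  truncation (rcons w a) i = truncation w i.
Proof.
have [x nx] := settle_rcons L_gt0 w a.
exists (settle L w x %% L).+1 => i iL ni; rewrite /truncation nx.
set n := settle L w.
have -> : threshold (add_chip n x) i = threshold n i.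
  apply/funext => v; rewrite /threshold; congr (_.-1 * L).
  rewrite !layerE // /add_chip; case: eqVneq => [->|_]; last by rewrite addn0.
  rewrite addn1 divnS // modnS; move: ni; set r := n x %% L => ni.
  have [dv|_] := boolP (L %| (n x).+1); last first.
    by rewrite add0n [i <= r.+1]leq_eqVlt (negPf ni).
  have rE : r.+1 = L.
    have := dv; rewrite /dvdn modnS dv /r => _.
    move: dv; rewrite {1}(divn_eq (n x) L) -addnS dvdn_addr ?dvdn_mull //.
    by move/dvdn_leq => /(_ isT) => ?; apply/eqP; rewrite eqn_leq ltn_mod L_gt0.
  case/andP: iL => i0; rewrite -rE leq_eqVlt (negPf ni) /= ltnS => ->.
  by rewrite leqNgt i0 addn0 addnC.
rewrite down_closure_rcons // /threshold.
have : layer n i a.1 <= blocks L (occ a.1 w).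
  case/andP: iL => i0 iL.
  rewrite -ltnS /layer ltn_divLR // mulSn.
  rewrite ltn_subLR ?(leq_trans iL) ?leq_addl // addnC addnCA ltn_add2l.
  by rewrite -add1n leq_add // settle_capped.
rewrite -/n; case: (layer n i a.1) => //= m.
by rewrite ltn_blocks // => /ltnW.
Qed.

(** The chips are as many as the letters, and every vertex holds fewer than [L]
    chips more than it has letters; so the number of chips that one vertex has
    lost is at most [L] times the number of vertices. *)
Lemma occ_threshold w i v : 0 < i <= L ->
  occ v w - threshold (settle L w) i v <= (#|Gamma| + 2) * L.
Proof.
move=> iL; set n := settle L w.
have hn : occ v w <= n v + #|Gamma| * L.
  have := sum_settle L w; rewrite (bigD1 v) //= [RHS](bigD1 v) //= -/n => e.
  rewrite -(leq_add2r (\sum_(u | u != v) occ u w)) -e -addnA leq_add2l.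
  apply: (@leq_trans (\sum_(u | u != v) (occ u w + L))).
    apply: leq_sum => u _; apply: leq_trans (settle_capped L_gt0 w u) _.
    exact/ltnW/blocks_lt.
  rewrite big_split /= addnC leq_add2r sum_nat_const leq_mul2r.
  by rewrite max_card orbT.
have hl : n v <= layer n i v * L + L.
  case/andP: iL => i0 iL; rewrite -mulSnr.
  have := ltn_ceil (n v + L - i) L_gt0; rewrite -/(layer n i v) => /ltnW.
  by apply: leq_trans; rewrite -addnBA // leq_addr.
have ht : layer n i v * L <= threshold n i v + L.
  by rewrite /threshold; case: (layer n i v) => //= m; rewrite mulSnr.
rewrite leq_subLR mulnDl mul2n -addnn [_ + (L + L)]addnC !addnA.
apply: leq_trans hn _; rewrite leq_add2r.
by apply: leq_trans hl _; rewrite leq_add2r.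
Qed.

Lemma truncation_near w i : 0 < i <= L -> exists r,
  pi w = (truncation w i * pi r)%g /\ size r <= #|Gamma| * ((#|Gamma| + 2) * L).
Proof.
move=> iL; have [r [e sr]] := down_closure_prefix (threshold (settle L w) i) w.
exists r; split=> //; apply: leq_trans sr _.
by rewrite -sum_nat_const; apply: leq_sum => v _; exact: occ_threshold.
Qed.

(** As [i] decreases, the layers change only at vertices with a partially filled
    block. These form a clique, and [f i] counts how many of them have changed;
    since the sets are nested, the count determines the truncation. *)
Lemma truncation_values w : exists f : nat -> nat,
  (forall i, 0 < i -> f i <= Sim Gamma) /\
  (forall i j, 0 < i <= L -> 0 < j <= L -> f i = f j ->
     truncation w i = truncation w j).
Proof.
set n := settle L w.
pose F i : {set Gamma} := finset (fun v => i <= n v %% L).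
exists (fun i => #|F i|); split=> [i i0|i j].
  apply: (@leq_bigmax_cond _ _ (fun K : {set Gamma} => #|K|)).
  apply/forall_inP => u; rewrite inE => iu; apply/forall_inP => v; rewrite inE => iv.
  apply/implyP => uv; apply: (fractional_adj L_gt0 (w := w) uv).
    by rewrite /dvdn -lt0n; exact: leq_trans iu.
  by rewrite /dvdn -lt0n; exact: leq_trans iv.
wlog ij : i j / i <= j => [H iL jL fij|iL jL fij].
  by have [ij|/ltnW ji] := leqP i j; [exact: H|symmetry; exact: H].
have FE : F j = F i.
  apply/eqP; rewrite eqEcard fij leqnn andbT.
  by apply/fintype.subsetP => v; rewrite !inE; exact: leq_trans.
rewrite /truncation; suff -> : threshold n i = threshold n j by [].
apply/funext => v; rewrite /threshold !layerE //.
by move/finset.setP: FE => /(_ v); rewrite !inE => ->.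
Qed.

End Layers.

(** * The upper bound *)

Section WordNorms.
Variables (Gamma : sgraph) (S : {fset raag Gamma}) (hS : generating S).
Local Notation letter := (Gamma * bool)%type.
Local Notation word := (seq letter).
Local Notation pi := (pres_pi (raag_relators Gamma)).

Lemma word_norm_letters : exists K, forall w : word,
  word_norm hS (pi w) <= K * size w.
Proof.
pose K := \max_(l : letter) word_norm hS (pi [:: l]).
exists K; elim=> [|l w IH]; first by rewrite pi_nil word_norm1.
rewrite pi_cons mulnS (leq_trans (word_normM _ _ _)) // leq_add //.
exact: (@leq_bigmax _ (fun l : letter => word_norm hS (pi [:: l]))).
Qed.

Lemma letters_word_norm : exists K, forall g : raag Gamma,
  exists2 w : word, pi w = g & size w <= K * word_norm hS g.
Proof.
pose K := \max_(s <- S) size (repr s : word).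
exists K => g; have [w [Sw <- <-]] := word_normP hS g.
elim: w Sw => [|s w IH] /=; first by exists [::]; rewrite // big_nil.
case/andP=> Ss /IH[u uw su].
suff [v vs sv] : exists2 v : word, pi v = s & size v <= K.
  by exists (v ++ u); rewrite ?pi_cat ?vs ?uw ?big_cons // size_cat mulnS leq_add.
have piE (x : raag Gamma) : pi (repr x) = x by rewrite /pres_pi reprK.
have leK (x : raag Gamma) : x \in S -> size (repr x : word) <= K.
  by move=> xS; apply: (@leq_bigmax_seq _ _ _ (fun x => size (repr x : word))).
case/orP: Ss => [/leK sK|/leK sK]; first by exists (repr s).
exists (fword_inv (repr (s^-1)%g)); first by rewrite pi_fword_inv piE invgK.
by rewrite /fword_inv size_rev size_map.
Qed.

End WordNorms.

Section UpperBound.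
Variables (Gamma : sgraph).
Local Notation word := (seq (Gamma * bool)).
Local Notation pi := (pres_pi (raag_relators Gamma)).

Lemma truncation_step L (x : raag Gamma) l : 0 < L -> exists i0, forall i,
  0 < i <= L -> i != i0 ->
  truncation L (word_of (x * pi [:: l])%g) i = truncation L (word_of x) i.
Proof.
move=> L0; have [h|h] := word_of_step x l.
  have [i0 hi] := truncation_rcons L0 (word_of x) l.
  by exists i0 => i iL ne; rewrite (truncation_same L0 _ h) hi.
have [i0 hi] := truncation_rcons L0 (word_of (x * pi [:: l])%g) (inv_letter l).
by exists i0 => i iL ne; rewrite (truncation_same L0 _ h) hi.
Qed.

Lemma truncation_path L (x : raag Gamma) (w : word) : 0 < L ->
  count (fun i => truncation L (word_of (x * pi w)%g) i
                  != truncation L (word_of x) i) (iota 1 L) <= size w.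
Proof.
move=> L0; elim/last_ind: w => [|w l IH].
  by rewrite pi_nil mulg1 (eq_count (a2 := pred0)) ?count_pred0 // => i; rewrite eqxx.
rewrite pi_rcons mulgA size_rcons; set y := (x * pi w)%g in IH *.
have [i0 hi] := truncation_step y l L0.
apply: (@leq_trans (count (fun i => truncation L (word_of y) i
                  != truncation L (word_of x) i) (iota 1 L)
  + count (pred1 i0) (iota 1 L))).
  rewrite -count_predUI -[leqLHS]addn0 leq_add //.
  have sub : {in iota 1 L, forall i, truncation L (word_of (y * pi [:: l])%g) i
     != truncation L (word_of x) i -> (i == i0) ||
     (truncation L (word_of y) i != truncation L (word_of x) i)}.
    move=> i; rewrite mem_iota add1n ltnS => iL.
    by have [//|ne] := eqVneq i i0; rewrite hi.
  rewrite -[leqLHS]size_filter -[leqRHS]size_filter uniq_leq_size //.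
    exact/filter_uniq/iota_uniq.
  move=> i; rewrite !mem_filter => /andP[ne il]; rewrite il andbT /= orbC.
  exact: sub.
rewrite count_uniq_mem ?iota_uniq // -[(size w).+1]addn1 leq_add //.
exact: leq_b1.
Qed.

End UpperBound.

Lemma pigeonhole (f : nat -> nat) (s : seq nat) k n :
  {in s, forall i, f i <= n} -> k * n.+1 < size s ->
  exists j, k < count (fun i => f i == j) s.
Proof.
move=> fn; have <- : \sum_(j < n.+1) count (fun i => f i == j) s = size s.
  elim: s fn => [|i s IH] fn /=; first by rewrite big1.
  rewrite big_split /= IH => [|i' si]; last by apply: fn; rewrite inE si orbT.
  rewrite -[(size s).+1]add1n; congr addn.
  have fi : f i < n.+1 by rewrite ltnS fn ?mem_head.
  rewrite (bigD1 (Ordinal fi)) //= eqxx big1 ?addn0 // => j.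
  by rewrite -val_eqE /= eq_sym => /negPf ->.
move=> lt; apply: contrapT => no; move: lt; rewrite ltnNge => /negP; apply.
rewrite mulnC -[n.+1 in leqRHS]card_ord -sum_nat_const.
by apply: leq_sum => j _; rewrite leqNgt; apply/negP => ?; apply: no; exists (val j).
Qed.

Section AsdimUpperBound.
Variables (R : realType) (Gamma : sgraph).
Variables (S : {fset raag Gamma}) (hS : generating S).
Local Notation word := (seq (Gamma * bool)).
Local Notation pi := (pres_pi (raag_relators Gamma)).
Local Notation W := (word_space R hS).

Lemma mdist_word (x y : W) :
  mdist x y = (word_norm hS ((x : raag Gamma)^-1 * y)%g)%:R%R.
Proof. by []. Qed.

(** The cover consists of the sets of those [x] whose truncations take a given
    value [z] at more than [k] levels, where [k] bounds the number of levels at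
    which the truncations of two points of an [r]-ball can differ. There are
    [Sim Gamma + 1] values for more than [k * (Sim Gamma + 1)] levels, whence
    the sets cover; and if a point of the ball around [x] has the value [z] at
    more than [k] levels, then [x] itself has it at one of them. *)
Lemma asdim_le_Sim : asdim_le W (Sim Gamma).
Proof.
move=> r r0.
have [K HK] := word_norm_letters hS; have [K' HK'] := letters_word_norm hS.
pose k := K' * Num.bound r; pose n := Sim Gamma.
(* Only the lower bound on L is kept, so that iota 1 L does not unfold. *)
have [L L0 kL] : exists2 L, 0 < L & k * n.+1 < L by exists (k * n.+1).+1.
pose T (x : raag Gamma) i := truncation L (word_of x) i.
pose U z : set W := [set x | k < count (fun i => T x i == z) (iota 1 L)]%classic.
have near x y : ball (x : W) r (y : W) ->
    count (fun i => T y i != T x i) (iota 1 L) <= k.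
  rewrite ballEmdist /= mdist_word => xy.
  have [w wE sw] := HK' ((x : raag Gamma)^-1 * y)%g.
  have -> : (y : raag Gamma) = (x * pi w)%g by rewrite wE mulVKg.
  apply: leq_trans (truncation_path x w L0) _.
  rewrite (leq_trans sw) // leq_mul2l; apply/orP; right.
  by rewrite -(ler_nat R) ltW // (lt_trans xy) // archi_boundP // ltW.
exists [set U z | z in [set: raag Gamma]]%classic; split.
- apply/seteqP; split=> // x _.
  have [f [fn fT]] := truncation_values L0 (word_of x).
  have [||j jk] := @pigeonhole f (iota 1 L) k n.
  + by move=> i; rewrite mem_iota => /andP[i0 _]; exact: fn.
  + by rewrite size_iota.
  have : has (fun i => f i == j) (iota 1 L) by rewrite has_count (leq_trans _ jk).
  case/hasP=> i iL /eqP fi; exists (U (T x i)); first by exists (T x i).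
  rewrite /U /=; apply: leq_trans jk _.
  rewrite -[leqLHS]size_filter -[leqRHS]size_filter uniq_leq_size //.
    exact/filter_uniq/iota_uniq.
  move=> i'; rewrite !mem_filter => /andP[/eqP fi' iL']; rewrite iL' andbT.
  by apply/eqP/fT; rewrite ?fi' ?fi //; [move: iL'|move: iL];
    rewrite mem_iota add1n ltnS.
- exists (K * (#|Gamma| * ((#|Gamma| + 2) * L)) * 2)%:R%R => _ [z _ <-] x y.
  have prefix (v : W) : U z v ->
      exists2 w, (v : raag Gamma) = (z * pi w)%g &
        size w <= #|Gamma| * ((#|Gamma| + 2) * L).
    rewrite /U /= => kv.
    have : has (fun i => T v i == z) (iota 1 L) by rewrite has_count (leq_trans _ kv).
    case/hasP=> i; rewrite mem_iota add1n ltnS => iL /eqP <-.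
    have [w [e sw]] := truncation_near L0 (word_of v) iL.
    by exists w => //; rewrite -e pi_word_of.
  move=> /prefix[w xw sw] /prefix[w' yw' sw'].
  rewrite mdist_word ler_nat xw yw' invgM -mulgA mulKg.
  rewrite (leq_trans (word_normM _ _ _)) // word_normV muln2 -addnn.
  by rewrite leq_add // (leq_trans (HK _)) // leq_mul2l ?sw ?sw' orbT.
move=> x; have [f [fn fT]] := truncation_values L0 (word_of x).
pose g j := T x (nth 0 [seq i <- iota 1 L | f i == j] 0).
have gE i : 0 < i <= L -> T x i = g (f i).
  move=> iL; rewrite /g; set s := [seq i <- iota 1 L | _].
  have : nth 0 s 0 \in s.
    rewrite mem_nth // size_filter -has_count; apply/hasP; exists i => //.
    by rewrite mem_iota add1n ltnS.
  rewrite mem_filter mem_iota add1n ltnS => /andP[/eqP e sL].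
  by apply: fT.
apply: card_le_trans (card_image_le (fun j => U (g j)) _).
apply: subset_card_le => _ [[z _ <-]] [y [Uzy bxy]].
have : has (fun i => (T y i == z) && (T x i == z)) (iota 1 L).
  apply/negP => /negP; rewrite has_count -leqNgt leqn0 => /eqP c0.
  move: Uzy; rewrite /U /= ltnNge => /negP; apply; apply: leq_trans (near _ _ bxy).
  rewrite -[leqLHS]size_filter -[leqRHS]size_filter uniq_leq_size //.
    exact/filter_uniq/iota_uniq.
  move=> i; rewrite !mem_filter => /andP[/eqP Ty iL]; rewrite iL andbT.
  apply/eqP => yx; move/eqP: c0; rewrite -leqn0 leqNgt -has_count => /negP; apply.
  by apply/hasP; exists i => //; rewrite -yx Ty eqxx.
case/hasP=> i; rewrite mem_iota add1n ltnS => iL /andP[_ /eqP Tx].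
exists (f i); last by rewrite -gE // Tx.
by rewrite /= ltnS fn //; case/andP: iL.
Qed.

End AsdimUpperBound.

(** * Sperner's lemma for a cube *)

Section Parity.

Lemma xor_involution (T : finType) (A F : pred T) (h : T -> T) :
  involutive h -> (forall x, A (h x) = A x) -> (forall x, F (h x) = F x) ->
  (forall x, A x -> h x != x) -> \big[addb/false]_(x | A x) F x = false.
Proof.
move=> hK hA hF hx; rewrite (bigID (fun x => enum_rank x < enum_rank (h x))) /=.
rewrite [X in _ (+) X](reindex_inj (inv_inj hK)) /=.
have addb_eq (a b : bool) : b = a -> a (+) b = false by move=> ->; exact: addbb.
apply: addb_eq.
apply: eq_big => [x|x _]; last by rewrite hF.
rewrite hA hK; case Ax : (A x) => //=.
rewrite -leqNgt leq_eqVlt val_eqE (inj_eq enum_rank_inj).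
by rewrite eq_sym (negPf (hx x Ax)).
Qed.

(** A facet that carries all the labels below [d] omits either the only vertex
    labelled [d], or one of the two vertices that share a label. *)
Lemma parity_of_faces d (f : 'I_d.+1 -> nat) : (forall k, f k <= d) ->
  [forall c : 'I_d.+1, exists k, f k == c] =
  \big[addb/false]_(j : 'I_d.+1) [forall c : 'I_d, exists k, (k != j) && (f k == c)].
Proof.
move=> fd.
have [all_hit|] := boolP [forall c : 'I_d, exists k, f k == c]; last first.
  rewrite negb_forall => /existsP[c]; rewrite negb_exists => /forallP nc.
  rewrite big1 => [|j _].
    apply/negbTE; rewrite negb_forall; apply/existsP.
    exists (widen_ord (leqnSn d) c).
    by rewrite negb_exists; apply/forallP => k; exact: nc.
  apply/negbTE; rewrite negb_forall; apply/existsP; exists c.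
  by rewrite negb_exists; apply/forallP => k; rewrite negb_and nc orbT.
(* A section g of the labels below d misses exactly one vertex j0. *)
have [g gf] : exists g : 'I_d -> 'I_d.+1, forall c, f (g c) = c.
  have /fin_all_exists[g gf] : forall c : 'I_d, exists k, f k = c.
    by move=> c; have /existsP[k /eqP fk] := forallP all_hit c; exists k.
  by exists g.
have g_inj : injective g by move=> c c' e; apply/val_inj; rewrite -[LHS]gf e gf.
have /cards1P[j0 Hj0] : #|~: [set g c | c : 'I_d]%SET| == 1.
  have := cardsC [set g c | c : 'I_d]%SET.
  rewrite card_imset // !card_ord => e.
  by apply/eqP/(@addnI d); rewrite e addn1.
have cases k : k = j0 \/ exists c, k = g c.
  have [kg|] := boolP (k \in [set g c | c : 'I_d]%SET).
    by right; case/imsetP: kg => c _ ->; exists c.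
  by rewrite -finset.in_setC Hj0 finset.in_set1 => /eqP; left.
have gj0 c : g c != j0.
  have : j0 \in ~: [set g c | c : 'I_d]%SET by rewrite Hj0 finset.set11.
  rewrite finset.in_setC; apply: contra => /eqP <-.
  exact: imset_f.
have face0 : [forall c : 'I_d, exists k, (k != j0) && (f k == c)].
  by apply/forallP => c; apply/existsP; exists (g c); rewrite gj0 gf eqxx.
have only (c : 'I_d) k : f k = c -> k = g c \/ (k = j0 /\ f j0 = c).
  by move=> fk; case: (cases k) => [kj|[c' kg]]; [right|left; move: fk];
    rewrite ?kg ?gf -?kj // => /val_inj ->.
have faceN (c : 'I_d) : f j0 != c ->
    [forall c' : 'I_d, exists k, (k != g c) && (f k == c')] = false.
  move=> ne; apply/negbTE; rewrite negb_forall; apply/existsP; exists c.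
  rewrite negb_exists; apply/forallP => k; rewrite negb_and negbK.
  rewrite orbC -implybE; apply/implyP => /eqP /only[->//|[_ e]].
  by rewrite e eqxx in ne.
rewrite (bigD1 j0) //= face0.
have [fj0|fj0] := eqVneq (f j0) d.
  rewrite big1 => [|j jj0]; last first.
    case: (cases j) => [e|[c ->]]; first by rewrite e eqxx in jj0.
    by apply: faceN; rewrite fj0 gtn_eqF.
  apply/forallP => c; case: (ltnP c d) => cd.
    by apply/existsP; exists (g (Ordinal cd)); rewrite gf.
  by apply/existsP; exists j0; rewrite fj0 eqn_leq cd -ltnS ltn_ord.
have lt : f j0 < d by rewrite ltn_neqAle fj0 fd.
pose c0 := Ordinal lt.
rewrite (bigD1 (g c0)) //= big1 => [|j /andP[jj0 jg]]; last first.
  case: (cases j) => [e|[c e]]; first by rewrite e eqxx in jj0.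
  rewrite e; apply: faceN; apply: contra jg => /eqP fc.
  by rewrite e; apply/eqP; congr g; apply: val_inj.
have -> : [forall c : 'I_d, exists k, (k != g c0) && (f k == c)] = true.
  apply/forallP => c; apply/existsP; have [->|cc0] := eqVneq c c0.
    by exists j0; rewrite eq_sym gj0 eqxx.
  by exists (g c); rewrite (inj_eq g_inj) cc0 gf eqxx.
apply/negbTE; rewrite negb_forall; apply/existsP; exists ord_max.
rewrite negb_exists; apply/forallP => k /=.
by case: (cases k) => [->//|[c ->]]; rewrite gf ltn_eqF.
Qed.

End Parity.

Section CubicalSperner.
Variables (m N : nat) (lab : ('I_m -> nat) -> nat).
Hypothesis N_gt0 : 0 < N.
Hypothesis lab_le : forall p, lab p <= m.
Hypothesis lab_low : forall p i, p i = 0 -> lab p <= i.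
Hypothesis lab_high : forall p i, p i = N -> lab p != i.
Local Notation point := {ffun 'I_m -> 'I_N.+1}.
Implicit Types (x y : point) (s : {perm 'I_m}) (i : 'I_m).

(** The vertices of the simplex of the Freudenthal triangulation given by the
    corner [x] and the permutation [s]: coordinate [i] is raised at step [s i]. *)
Definition vtx x s k : 'I_m -> nat := fun i => x i + (s i < k).

(** The corners of the unit cubes in the face spanned by the first [d]
    coordinates. All the faces live in the same ambient cube, so that no
    change of index type occurs in the induction on [d]. *)
Definition box d x := [forall i : 'I_m, if i < d then x i < N else x i == 0 :> nat].

Definition fixes d s := [forall i : 'I_m, (d <= i) ==> (s i == i)].

Definition full d x s :=
  [forall c : 'I_d.+1, exists k : 'I_d.+1, lab (vtx x s k) == c].

Definition total d :=
  \big[addb/false]_(s | fixes d s) \big[addb/false]_(x | box d x) full d x s.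

Lemma total0 : total 0 = true.
Proof.
rewrite /total (big_pred1 (1%g : {perm 'I_m})) => [|s]; last first.
  apply/forallP/eqP => [h|-> i]; last by rewrite perm1 eqxx.
  by apply/permP => i; rewrite perm1; apply/eqP/h.
rewrite (big_pred1 [ffun=> ord0]) => [|x]; last first.
  apply/forallP/eqP => [h|-> i]; last by rewrite ffunE.
  by apply/ffunP => i; rewrite ffunE; apply/val_inj/eqP/h.
apply/forallP => c; apply/existsP; exists ord0.
rewrite (ord1 c); set p := vtx _ _ _; rewrite -leqn0.
have [m0|m0] := posnP m; first by rewrite (leq_trans (lab_le _)) ?m0.
by apply: (@lab_low p (Ordinal m0)); rewrite /p /vtx ffunE.
Qed.

Definition facet d j x s :=
  [forall c : 'I_d, exists k : 'I_d.+1, (k != j) && (lab (vtx x s k) == c)].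

Lemma fixes_ge d s i : fixes d s -> d <= i -> s i = i.
Proof. by move=> /forallP fs di; have /implyP/(_ di)/eqP := fs i. Qed.

Lemma fullE d x s : d <= m -> box d x -> fixes d s ->
  full d x s = \big[addb/false]_(j : 'I_d.+1) facet j x s.
Proof.
move=> dm bx fs.
apply: (parity_of_faces (f := fun k : 'I_d.+1 => lab (vtx x s k))) => k.
move: dm; rewrite leq_eqVlt => /orP[/eqP dmE|dm].
  by rewrite (leq_trans (lab_le _)) // dmE.
apply: (@lab_low _ (Ordinal dm)); rewrite /vtx (fixes_ge fs) //=.
have /= := forallP bx (Ordinal dm); rewrite ltnn => /eqP ->.
by rewrite ltnNge -ltnS ltn_ord.
Qed.

(** An inner facet of a cube belongs to two simplices, whose permutations differ
    by exchanging the two steps around the omitted vertex. *)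
Lemma inner_facets d (j : 'I_d.+1) x : d <= m -> 0 < j < d ->
  \big[addb/false]_(s | fixes d s) facet j x s = false.
Proof.
move=> dm /andP[j0 jd].
have j1m : j.-1 < m by rewrite (leq_trans (leq_ltn_trans (leq_pred j) jd)).
have jm : j < m by rewrite (leq_trans jd).
pose a := Ordinal j1m; pose b := Ordinal jm.
have ab : a != b by rewrite -val_eqE /= -{2}(prednK j0) neq_ltn ltnSn.
have fix1 s : fixes d s -> fixes d (s * tperm a b)%g.
  move=> fs; apply/forallP => i; apply/implyP => di.
  rewrite permM (fixes_ge fs di) tpermD // -val_eqE /= neq_ltn.
    by rewrite (leq_trans (leq_ltn_trans (leq_pred j) jd)).
  by rewrite (leq_trans jd).
have invK : involutive (fun s => s * tperm a b)%g.
  by move=> s; rewrite -mulgA tperm2 mulg1.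
apply: (xor_involution invK) => [s|s|s _].
- by apply/idP/idP => [/fix1|/fix1//]; rewrite invK.
- apply: eq_forallb => c; apply: eq_existsb => k; case: eqVneq => //= kj.
  have jk : (j.-1 < k) = (j < k).
    by rewrite prednK // leq_eqVlt val_eqE eq_sym (negPf kj).
  congr (lab _ == _); apply/funext => i; rewrite /vtx permM; congr (_ + _).
  by case: tpermP => [->|->|//]; rewrite /= jk.
apply/eqP => /(congr1 (fun t => s^-1 * t)%g); rewrite mulKg mulVg.
move=> /permP/(_ a); rewrite tpermL perm1 => e.
by rewrite -e eqxx in ab.
Qed.

Lemma last_facet d x s : facet (ord_max : 'I_d.+2) x s = full d x s.
Proof.
apply: eq_forallb => c; apply/existsP/existsP => [[k /andP[kd lk]]|[k lk]].
  have kd' : k < d.+1 by rewrite ltn_neqAle -ltnS ltn_ord andbT.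
  by exists (Ordinal kd').
exists (widen_ord (leqnSn _) k); rewrite lk andbT -val_eqE /=.
by rewrite ltn_eqF.
Qed.

Section Rotation.
Variables (d : nat) (dm : d < m).

(** Makes step 0 the last one, for the first [d + 1] steps. *)
Definition rotation_fun (j : 'I_m) : 'I_m :=
  if j == 0 :> nat then Ordinal dm else
  if j <= d then Ordinal (leq_ltn_trans (leq_pred j) (ltn_ord j)) else j.

Lemma rotation_funE (j : 'I_m) :
  rotation_fun j = (if j == 0 :> nat then d else if j <= d then j.-1 else j) :> nat.
Proof. by rewrite /rotation_fun; case: eqP => // _; case: ifP. Qed.

Lemma rotation_fun_inj : injective rotation_fun.
Proof.
move=> j k /(congr1 val); rewrite /= !rotation_funE => e; apply: val_inj => /=.
move: e; case: (nat_of_ord j) => [|j'] /=; case: (nat_of_ord k) => [|k'] //=.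
- by case: ltnP => h e; [rewrite e ltnn in h | rewrite e ltnn in h].
- by case: ltnP => h e; [rewrite -e ltnn in h | rewrite -e ltnn in h].
- case: ltnP => hj; case: ltnP => hk // e.
  + by rewrite e.
  + by move: hj; rewrite e ltnNge ltnW.
  + by move: hk; rewrite -e ltnNge ltnW.
Qed.

Definition rotation : {perm 'I_m} := perm rotation_fun_inj.

Lemma rotation_ge (j : 'I_m) : d < j -> rotation j = j.
Proof.
move=> dj; apply: val_inj; rewrite permE /= rotation_funE leqNgt dj.
by case: eqP dj => // ->.
Qed.

Lemma fixes_rotation s : fixes d.+1 (s * rotation)%g = fixes d.+1 s.
Proof.
apply: eq_forallb => i; case: leqP => // di; rewrite !implyTb permM.
by rewrite -{2}(rotation_ge di) (inj_eq perm_inj).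
Qed.

Definition shift i x : point := [ffun k => if k == i then inord (x k).+1 else x k].

Definition last_step s : 'I_m := (s^-1)%g (Ordinal dm).

Lemma last_stepP s : s (last_step s) = Ordinal dm.
Proof. exact: permKV. Qed.

(** Omitting the first vertex of a simplex leaves the facet that omits the last
    vertex of a simplex in the neighbouring cube, in the direction of the first
    step. *)
Lemma first_facet x s : box d.+1 x -> fixes d.+1 s ->
  facet (ord0 : 'I_d.+2) x s =
  full d (shift (last_step (s * rotation)%g) x) (s * rotation)%g.
Proof.
move=> bx fs; set t := (s * rotation)%g; set i := last_step t.
have si0 : s i = 0 :> nat.
  have /(congr1 val) := last_stepP t; rewrite -/i permM permE /= rotation_funE.
  case: (posnP (s i)) => // s_gt0; case: leqP => h e; last by rewrite e ltnn in h.
  by rewrite -(prednK s_gt0) e ltnn in h.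
have id : i < d.+1.
  rewrite ltnNge; apply/negP => di; move: si0.
  by rewrite (fixes_ge fs di) => i0; rewrite i0 in di.
have bxi : x i < N by have := forallP bx i; rewrite id.
have tE (j : 'I_m) (k : nat) : j != i -> k <= d -> (t j < k) = (s j < k.+1).
  move=> ji kd; rewrite /t permM permE /= rotation_funE.
  case: (posnP (s j)) => [sj0|s_gt0].
    by case/eqP: ji; apply: (@perm_inj _ s); apply: val_inj; rewrite /= sj0 si0.
  case: (leqP (s j) d) => h; first by rewrite -[in RHS](prednK s_gt0) ltnS.
  by rewrite [LHS]ltnNge [RHS]ltnNge (leq_trans kd (ltnW h)) (leq_ltn_trans kd h).
have vtxE (k : nat) : k <= d -> vtx (shift i x) t k = vtx x s k.+1.
  move=> kd; apply/funext => j; rewrite /vtx /shift ffunE.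
  have [->|ji] := eqVneq j i; last by rewrite tE.
  rewrite inordK ?ltnS // last_stepP /= si0 ltnNge kd /=.
  by rewrite addn0 addn1.
apply: eq_forallb => c; apply/existsP/existsP => [[k /andP[k0 lk]]|[k lk]].
  have kd : k.-1 < d.+1 by rewrite prednK ?lt0n // -ltnS ltn_ord.
  by exists (Ordinal kd); rewrite vtxE //= prednK ?lt0n.
exists (lift ord0 k); rewrite /= /bump /= add1n -vtxE ?lk ?andbT //.
by rewrite -ltnS.
Qed.

(** Direction [i] is the last step, so the facet lies in the face [x i = N],
    where the label [i] is excluded. *)
Lemma full_high i x s : i < d.+1 -> s i = Ordinal dm -> x i = N :> nat ->
  full d x s = false.
Proof.
move=> id si xN; apply/negbTE; rewrite negb_forall; apply/existsP.
exists (Ordinal id); rewrite negb_exists; apply/forallP => k /=.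
apply: lab_high; rewrite /vtx si /= xN ltnNge -ltnS ltn_ord addn0 //.
Qed.

(** Here the facet lies in the face [x i = 0], where the labels are at most [i],
    and so [d] is missing. *)
Lemma full_low i x s : i < d -> s i = Ordinal dm -> x i = 0 :> nat ->
  full d x s = false.
Proof.
move=> id si x0; apply/negbTE; rewrite negb_forall; apply/existsP.
exists ord_max; rewrite negb_exists; apply/forallP => k /=.
rewrite ltn_eqF // (leq_ltn_trans _ id) //; apply: lab_low.
by rewrite /vtx si /= x0 ltnNge -ltnS ltn_ord.
Qed.

Definition slab i x :=
  [forall j : 'I_m, (j != i) ==> if j < d.+1 then x j < N else x j == 0 :> nat].

Lemma box_slab i x : i < d.+1 -> box d.+1 x = slab i x && (x i < N).
Proof.
move=> id; apply/forallP/andP => [bx|[/forallP sx xi] j].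
  split; last by have := bx i; rewrite id.
  by apply/forallP => j; apply/implyP => _; exact: bx.
have [->|ji] := eqVneq j i; first by rewrite id.
by have := sx j; rewrite ji.
Qed.

Lemma sum_shift i (F : pred point) : i < d.+1 ->
  \big[addb/false]_(x | box d.+1 x) F (shift i x) =
  \big[addb/false]_(x | slab i x && (0 < x i)) F x.
Proof.
move=> id; pose unshift x : point := [ffun k => if k == i then inord (x k).-1 else x k].
have slabE x y : (forall j, j != i -> x j = y j) -> slab i x = slab i y.
  by move=> xy; apply: eq_forallb => j; case: eqVneq => //= ji; rewrite xy.
rewrite [RHS](reindex_onto (shift i) unshift) /=; last first.
  move=> x /andP[_ xi]; apply/ffunP => j; rewrite !ffunE.
  have e : (inord (x i).-1 : 'I_N.+1) = (x i).-1 :> nat.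
    by rewrite inordK // (leq_ltn_trans (leq_pred _)).
  by case: eqVneq => // ->; rewrite e prednK // inord_val.
apply: eq_bigl => x; rewrite (box_slab _ id) (slabE (shift i x) x); last first.
  by move=> j /negPf ji; rewrite ffunE ji.
case: slab => //=; rewrite ffunE eqxx.
case: (ltnP (x i) N) => xi.
  rewrite inordK ?ltnS //=; apply/esym/eqP/ffunP => j; rewrite !ffunE.
  by case: eqVneq => // ->; apply: val_inj; rewrite /= !inordK // ltnS // ltnW.
by rewrite /inord /insubd insubF // ltnS ltnNge xi.
Qed.

(** The facets orthogonal to direction [i] cancel between consecutive cubes; the
    boundary terms vanish by [full_high] and [full_low] unless [i] is the last
    direction, where the face [x i = 0] is the box of one dimension less. *)
Lemma total_telescope s (i := last_step s) : fixes d.+1 s ->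
  \big[addb/false]_(x | box d.+1 x) full d (shift i x) s (+)
  \big[addb/false]_(x | box d.+1 x) full d x s =
  if fixes d s then \big[addb/false]_(x | box d x) full d x s else false.
Proof.
move=> fs; have si : s i = Ordinal dm by exact: last_stepP.
have id : i < d.+1.
  rewrite ltnNge; apply/negP => di.
  by have := di; rewrite -(fixes_ge fs di) si /= ltnn.
rewrite (sum_shift (fun x => full d x s) id).
rewrite (bigID (fun x : point => x i < N)) /= [X in _ (+) X (+) _]big1 =>
    [|x]; last first.
  case/andP=> _ xi; apply: (full_high id si); apply/eqP.
  by rewrite eqn_leq -ltnS ltn_ord leqNgt.
rewrite addbF [X in _ (+) X](eq_bigl (fun x : point => slab i x && (x i < N)));
  last first.
  by move=> x; exact: (box_slab x id).
rewrite [X in _ (+) X](bigID (fun x : point => 0 < x i)) /= addbA.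
under [X in X (+) _ (+) _]eq_bigl => x do rewrite andbAC.
rewrite addbb addFb.
case: ifP => fs'.
  have idd : i = Ordinal dm.
    by apply: (@perm_inj _ s); rewrite si (fixes_ge fs').
  have ltd (j : 'I_m) : j != i -> (j < d.+1) = (j < d).
    rewrite idd ltnS leq_eqVlt => ji; suff /negPf -> : j != d :> nat by [].
    by apply: contra ji => /eqP jd; apply/eqP/val_inj.
  have xi0 x : ~~ (0 < x i) = (x i == 0 :> nat) by rewrite lt0n negbK.
  apply: eq_bigl => x; rewrite xi0.
  apply/andP/forallP => [[/andP[/forallP sx _] x0] j|bx].
    have := sx j; have [->|ji] := eqVneq j i; last by rewrite ltd.
    by move=> _; rewrite {1}idd /= ltnn.
  have /= := bx i; rewrite {1}idd /= ltnn => /eqP x0; split; last by rewrite x0.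
  rewrite x0 N_gt0 andbT; apply/forallP => j; apply/implyP => ji.
  by rewrite ltd //; exact: bx.
rewrite big1 // => x /andP[_ x0]; apply: (full_low _ si); last first.
  by apply/eqP; rewrite -leqn0 leqNgt.
rewrite ltn_neqAle -ltnS id andbT; apply/eqP => idd.
have iE : i = Ordinal dm by apply: val_inj.
move/negP: fs'; apply; apply/forallP => j; apply/implyP => dj.
move: dj; rewrite leq_eqVlt => /orP[/eqP dj|dj]; last by rewrite (fixes_ge fs dj).
have -> : j = i by apply: val_inj; rewrite /= idd.
by rewrite si iE.
Qed.

(** Sperner's count: the fully labelled simplices and the fully labelled boundary
    facets have the same parity. *)
Lemma totalS : total d.+1 = total d.
Proof.
have fixS s : fixes d s -> fixes d.+1 s.
  by move=> /forallP fs; apply/forallP => j; apply/implyP => /ltnW dj;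
    have /implyP/(_ dj) := fs j.
rewrite /total.
transitivity (\big[addb/false]_(s | fixes d.+1 s) \big[addb/false]_(x | box d.+1 x)
   \big[addb/false]_(j : 'I_d.+2) facet j x s).
  by apply: eq_bigr => s fs; apply: eq_bigr => x bx; exact: fullE.
transitivity (\big[addb/false]_(j : 'I_d.+2) \big[addb/false]_(x | box d.+1 x)
   \big[addb/false]_(s | fixes d.+1 s) facet j x s).
  rewrite [RHS]exchange_big /= [LHS]exchange_big /=.
  by apply: eq_bigr => x _; rewrite exchange_big.
rewrite (bigD1 ord0) //= (bigD1 ord_max) //=
  [X in _ (+) (_ (+) X)]big1 ?addbF => [|j /andP[j0 jm]]; last first.
  rewrite big1 // => x _; apply: inner_facets => //.
  rewrite lt0n -val_eqE in j0 *; rewrite j0 ltn_neqAle -ltnS ltn_ord andbT.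
  by rewrite -val_eqE in jm.
rewrite [X in X (+) _]exchange_big /= [X in _ (+) X]exchange_big /=.
pose G s := \big[addb/false]_(x | box d.+1 x) full d (shift (last_step s) x) s.
have -> : \big[addb/false]_(s | fixes d.+1 s) \big[addb/false]_(x | box d.+1 x)
    facet (ord0 : 'I_d.+2) x s = \big[addb/false]_(s | fixes d.+1 s) G s.
  rewrite [RHS](reindex_inj (mulIg rotation)) /=.
  apply: eq_big => [s|s fs]; first by rewrite fixes_rotation.
  by apply: eq_bigr => x bx; exact: first_facet.
rewrite -big_split /=.
transitivity (\big[addb/false]_(s | fixes d.+1 s)
    if fixes d s then \big[addb/false]_(x | box d x) full d x s else false).
  apply: eq_bigr => s fs; rewrite -total_telescope //; congr addb.
  by apply: eq_bigr => x _; exact: last_facet.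
rewrite -big_mkcondr; apply: eq_bigl => s.
by rewrite andb_idl //; exact: fixS.
Qed.

End Rotation.

Lemma total_true d : d <= m -> total d = true.
Proof. by elim: d => [|d IH] dm; [exact: total0|rewrite totalS // IH // ltnW]. Qed.

(** The boundary conditions are those of Kuhn's cubical version of Sperner's
    lemma; the labels are found in one unit cube. *)
Theorem cubical_sperner : exists p : 'I_m -> nat, forall c, c <= m ->
  exists2 q : 'I_m -> nat, (forall i, p i <= q i <= (p i).+1) & lab q = c.
Proof.
have : total m = true by exact: total_true.
have [[x /existsP[s /forallP fxs]] _|no] :=
  pselect (exists x, [exists s, full m x s]).
  exists (fun i => x i) => c cm.
  have /existsP[k /eqP lk] := fxs (Ordinal (cm : c < m.+1)).
  by exists (vtx x s k) => // i; rewrite leq_addr -[(x i).+1]addn1 leq_add2l leq_b1.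
rewrite /total big1 // => s _; rewrite big1 // => x _; apply/negbTE/negP => f.
by apply: no; exists x; apply/existsP; exists s.
Qed.

End CubicalSperner.

(** * The lower bound *)

Section Exponents.
Variable Gamma : sgraph.
Local Notation letter := (Gamma * bool)%type.
Local Notation word := (seq letter).
Local Notation pi := (pres_pi (raag_relators Gamma)).
Local Open Scope ring_scope.

Definition word_exponent (u : Gamma) (w : word) : int :=
  \sum_(l <- w) (if l.1 == u then (-1) ^+ l.2 else 0).

(** The homomorphism to the integers that sends [u] to 1 and the other generators
    to 0. *)
Definition exponent (u : Gamma) (x : raag Gamma) : int :=
  word_exponent u (repr x).

Lemma word_exponent_eqv u v w : pres_eqv (raag_relators Gamma) v w ->
  word_exponent u v = word_exponent u w.
Proof.
rewrite /word_exponent.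
elim=> {v w} [//|v w _ ->//|v w t _ -> _ ->//|v w x b|v r w].
  rewrite !big_cat !big_cons /=; congr (_ + _).
  by case: eqP => _; rewrite ?add0r // addrA; case: b;
    rewrite /= ?expr0 ?expr1 ?subrr ?addNr ?add0r.
move=> [x [y [_ ->]]]; rewrite !big_cat !big_cons big_nil /=; congr (_ + _).
by case: (x == u); case: (y == u); rewrite ?expr0 ?expr1 ?addr0 ?add0r // ?addrA;
  rewrite ?subrr ?add0r ?addr0 // ?addrK ?subrr ?add0r.
Qed.

Lemma exponent_pi u w : exponent u (pi w) = word_exponent u w.
Proof. exact/word_exponent_eqv/pres_repr. Qed.

Lemma exponent1 u : exponent u 1%g = 0.
Proof. by rewrite -(pi_nil Gamma) exponent_pi /word_exponent big_nil. Qed.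

Lemma exponentM u x y : exponent u (x * y)%g = exponent u x + exponent u y.
Proof.
elim/pres_ind: x => v; elim/pres_ind: y => w.
by rewrite -pi_cat !exponent_pi /word_exponent big_cat.
Qed.

Lemma exponent_gen u v : exponent u (raag_gen v) = (v == u)%:R.
Proof.
rewrite [LHS](exponent_pi u [:: (v, false)]) /word_exponent big_seq1 /=.
by case: eqP.
Qed.

Lemma exponentX u x k : exponent u (x ^+ k)%g = exponent u x *+ k.
Proof.
by elim: k => [|k IH]; rewrite ?expg0 ?exponent1 // expgS exponentM IH mulrS. Qed.

Lemma word_exponent_le u w : `|word_exponent u w| <= (size w)%:R.
Proof.
elim: w => [|l w IH]; first by rewrite /word_exponent big_nil normr0.
rewrite /word_exponent big_cons (le_trans (ler_normD _ _)) //= -natr1 addrC lerD //.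
by case: eqP => _; rewrite ?normr0 // normrX normrN1 expr1n.
Qed.

End Exponents.

Section CliqueCubes.
Variables (Gamma : sgraph) (n : nat) (vert : 'I_n -> Gamma).
Hypothesis vert_inj : injective vert.
Hypothesis vert_adj : forall i j, i != j -> adj (vert i) (vert j).
Local Open Scope group_scope.

Definition cube (p : 'I_n -> nat) : raag Gamma :=
  \prod_i raag_gen (vert i) ^+ p i.

Lemma cubeD p q : cube (fun i => p i + q i)%N = cube p * cube q.
Proof.
rewrite /cube -prodgM_commute; first by apply: eq_bigr => i _; rewrite expgnDr.
move=> i j _ _; apply: commuteX2.
have [->|ij] := eqVneq i j; first exact: commute_refl.
exact: (@pi_commute _ (vert i, false) (vert j, false)) (vert_adj ij).
Qed.

Lemma exponent_cube i p : exponent (vert i) (cube p) = (p i)%:R%R.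
Proof.
rewrite /cube (big_morph (exponent (vert i)) (exponentM _) (exponent1 _)).
rewrite (bigD1 i) //= big1 => [|j ji]; last first.
  by rewrite exponentX exponent_gen (inj_eq vert_inj) (negPf ji) mul0rn.
by rewrite exponentX exponent_gen eqxx addr0.
Qed.

Lemma unit_cube_norm (S : {fset raag Gamma}) (hS : generating S) : exists K,
  forall p : 'I_n -> nat, (forall i, p i <= 1) -> word_norm hS (cube p) <= n * K.
Proof.
pose K := \max_(i < n) word_norm hS (raag_gen (vert i)).
exists K => p p1; apply: (@leq_trans (\sum_(i < n) K)); last first.
  by rewrite sum_nat_const card_ord.
rewrite /cube; elim/big_rec2: _ => [|i k x _ IH]; first by rewrite word_norm1.
rewrite (leq_trans (word_normM _ _ _)) // leq_add //.
have := p1 i; case: (p i) => [|[|//]] _; first by rewrite expg0 word_norm1.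
rewrite expg1; exact: (@leq_bigmax _ (fun i => word_norm hS (raag_gen (vert i)))).
Qed.

End CliqueCubes.

Section AsdimLowerBound.
Variables (R : realType) (Gamma : sgraph).
Variables (S : {fset raag Gamma}) (hS : generating S).
Local Notation word := (seq (Gamma * bool)).
Local Notation pi := (pres_pi (raag_relators Gamma)).
Local Notation W := (word_space R hS).

(** Choose for each lattice point a member of the cover that contains it, and
    label it by the first direction [i] such that this member reaches the face
    [q i = 0], or by [n]. A bounded set does not reach two opposite faces of a
    large cube, so Sperner's conditions hold, and a unit cube with all the
    labels meets [n + 1] members of the cover. *)
Lemma asdim_ge_clique n (vert : 'I_n -> Gamma) m : injective vert ->
  (forall i j, i != j -> adj (vert i) (vert j)) -> asdim_le W m -> n <= m.
Proof.
move=> vert_inj vert_adj asW.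
have [K hK] := unit_cube_norm vert hS.
have [K' hK'] := letters_word_norm hS.
have [|U [Ucov [D HD] Umult]] := asW (n * K).+1%:R%R; first by rewrite ltr0Sn.
have /choice[A AU] (p : 'I_n -> nat) : exists B : set W, U B /\ B (cube vert p).
  have : (\bigcup_(B in U) B)%classic (cube vert p : W) by rewrite Ucov.
  by case=> B UB Bp; exists B.
(* Exponents are K'-Lipschitz and members of the cover have diameter at
   most D, so none of them meets two opposite faces of a cube of side N. *)
pose N := (K' * Num.bound D).+1.
have far p q i B : U B -> B (cube vert p) -> B (cube vert q) ->
    p i = 0 -> q i = N -> False.
  move=> UB Bp Bq pi0 qiN.
  have := HD _ UB _ _ Bp Bq; rewrite mdist_word => le_D.
  have D0 : (0 <= D)%R by apply: le_trans le_D; exact: ler0n.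
  have [w wE sw] := hK' ((cube vert p)^-1 * cube vert q)%g.
  have /(congr1 (exponent (vert i))) : (cube vert q = cube vert p * pi w)%g.
    by rewrite wE mulVKg.
  rewrite exponentM !exponent_cube // pi0 qiN add0r exponent_pi => e.
  have := word_exponent_le (vert i) w; rewrite -e normr_nat ler_nat.
  rewrite leqNgt => /negP; apply.
  rewrite ltnS (leq_trans sw) // leq_mul2l; apply/orP; right.
  by rewrite -(ler_nat R) ltW // (le_lt_trans le_D) // archi_boundP.
pose touches (B : set W) (i : 'I_n) := exists2 q, q i = 0 & B (cube vert q).
pose lab (B : set W) := find (fun i => `[< touches B i >]) (enum 'I_n).
have [] := @cubical_sperner n N (fun p => lab (A p)).
- by [].
- by move=> p; rewrite /lab (leq_trans (find_size _ _)) // size_enum_ord.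
- move=> p i pi0; rewrite leqNgt; apply/negP => /(before_find i).
  rewrite nth_ord_enum => /asboolP; apply; exists p => //.
  by case: (AU p).
- move=> p i piN; apply/eqP => labi.
  have hs : has (fun i => `[< touches (A p) i >]) (enum 'I_n).
    by rewrite has_find -/(lab (A p)) labi size_enum_ord.
  have := nth_find i hs; rewrite -/(lab (A p)) labi nth_ord_enum => /asboolP[q qi0 Aq].
  by have [UA Ap] := AU p; exact: (far q p i (A p)).
move=> p Hp.
have /choice[q Hq] (c : nat) : exists q : 'I_n -> nat, c <= n ->
    (forall i, p i <= q i <= (p i).+1) /\ lab (A q) = c.
  by have [/Hp[q qp ql]|_] := boolP (c <= n); [exists q|exists p].
rewrite -ltnS -card_le_II; apply: card_le_trans (Umult (cube vert p)).
have Aq_inj : {in `I_n.+1%classic &, injective (fun c => A (q c))}.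
  move=> c c' /set_mem/= cn /set_mem/= cn' e.
  by rewrite -(Hq c cn).2 -(Hq c' cn').2 e.
apply: (@card_le_trans _ _ _ ((fun c => A (q c)) @` `I_n.+1)%classic).
  by rewrite (card_le_eqr (inj_card_eq Aq_inj)).
apply: subset_card_le => _ [c cn <-].
have [UA Ac] := AU (q c); split=> //.
exists (cube vert (q c)); split=> //.
rewrite ballEmdist /= mdist_word ltr_nat ltnS.
have [qp _] := Hq c cn.
have -> : cube vert (q c) = (cube vert p * cube vert (fun i => q c i - p i)%N)%g.
  rewrite -cubeD //; congr cube; apply/funext => i.
  by rewrite subnKC //; case/andP: (qp i).
rewrite mulKg; apply: hK => i; rewrite leq_subLR addn1.
by case/andP: (qp i).
Qed.

Lemma asdim_ge_Sim m : asdim_le W m -> Sim Gamma <= m.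
Proof.
have [K cK ->] : exists2 K : {set Gamma}, is_clique K & Sim Gamma = #|K|.
  have c0 : is_clique (finset.set0 : {set Gamma}).
    by apply/forall_inP => u; rewrite finset.in_set0.
  have [|K cK] := @eq_bigmax_cond _ (@is_clique Gamma) (fun K : {set Gamma} => #|K|).
    by apply/card_gt0P; exists finset.set0.
  by exists K.
apply: (@asdim_ge_clique _ (fun i : 'I_#|K| => enum_val i)); first exact: enum_val_inj.
move=> i j ij; have /forall_inP/(_ _ (enum_valP i))/forall_inP := cK.
move=> /(_ _ (enum_valP j))/implyP; apply.
by rewrite (inj_eq enum_val_inj).
Qed.

End AsdimLowerBound.

Theorem theorem1p2 (R : realType) (Gamma : sgraph)
    (S : {fset raag Gamma}) (hS : generating S) :
  asdim (word_space R hS) = ((Sim Gamma)%:R%:E)%R.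
Proof.
apply/eqP; rewrite eq_le; apply/andP; split.
  by apply: ereal_inf_lbound; exists (Sim Gamma); [exact: asdim_le_Sim|].
apply: le_ereal_inf_tmp => _ [m Wm <-].
by rewrite lee_fin ler_nat; exact: asdim_ge_Sim Wm.
Qed.
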